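(* Let $p\in(1/2,1)$ and let $(N_k)_{k\ge 1}$ be a sequence of positive integers. For $x\in\{0,1\}^{\mathbb N}$ let $M_k^x(\omega)=\#\{1\le j\le N_k:(x_j,\dots,x_{j+k-1})=\omega\}$, regarded as a random variable in the random word $\omega\in\{0,1\}^k$ with law $\mathrm{Ber}(p)^k$; write $\mathbb P$ for probabilities with respect to this law. Then for $\mathrm{Ber}(p)^{\mathbb N}$-almost every $x\in\{0,1\}^{\mathbb N}$, as $k\to\infty$: (1) If $N_k=o\bigl(2^{kH(p)}a^{\sqrt k}\bigr)$ for all $a>0$, then $\mathbb P(M_k^x=0)\to 1$. (2) If $N_k=\omega\bigl(2^{kH(p)}a^{\sqrt k}\bigr)$ for all $a>0$, then $\mathbb P(M_k^x\ge n)\to 1$ for every integer $n\ge 0$. (3) If $N_k=\Theta\bigl(2^{kH(p)}a^{\sqrt k}\bigr)$ for some $a>0$, then $$\lim_{k\to\infty}\mathbb P(M_k^x=0)=\Phi\left(-\frac{\log_{p/(1-p)}(a)}{\sqrt{p(1-p)}}\right),$$ and $\lim_{k\to\infty}\mathbb P(M_k^x=n)=0$ for every integer $n\ge1$.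
   Context: $\mathbb N=\{1,2,3,\dots\}$. $\mathrm{Ber}(p)=p\delta_1+(1-p)\delta_0$ is the Bernoulli law on $\{0,1\}$; $\mathrm{Ber}(p)^k$ and $\mathrm{Ber}(p)^{\mathbb N}$ are the product measures on $\{0,1\}^k$ and $\{0,1\}^{\mathbb N}$. $H(p)=-p\log_2 p-(1-p)\log_2(1-p)$ is the binary entropy. $\Phi(s)=\frac1{\sqrt{2\pi}}\int_{-\infty}^s e^{-t^2/2}\,dt$ is the standard Gaussian distribution function. For positive sequences: $u_k=o(v_k)$ means $u_k/v_k\to0$; $u_k=\omega(v_k)$ means $u_k/v_k\to\infty$; $u_k=\Theta(v_k)$ means there are constants $C_1,C_2>0$ with $C_1\le u_k/v_k\le C_2$ for all sufficiently large $k$. *)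

(* Defs.v *)
From HB Require Import structures.
From mathcomp Require Import all_boot all_order all_algebra.
From mathcomp Require Import all_classical all_reals all_analysis.
From mathcomp Require Import measurable_realfun.
Set Implicit Arguments.
Unset Strict Implicit.
Unset Printing Implicit Defensive.
Import Order.TTheory GRing.Theory Num.Theory.
Import numFieldNormedType.Exports.
Local Open Scope classical_set_scope.
Local Open Scope ring_scope.

(* {0,1}^N with the product sigma-algebra, generated by the coordinate maps.
   Sequences are indexed from 0, so [x i] stands for the letter x_(i+1). *)
Definition coord_sets : set (set (nat -> bool)) :=
  [set A | exists (i : nat) (B : set bool), A = [set x | B (x i)]].

Definition binseq := g_sigma_algebraType coord_sets.

(* With this 0-based indexing, the word (x_(j+1), ..., x_(j+k)). *)
Definition window (x : binseq) (j k : nat) : k.-tuple bool :=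
  [tuple x (j + i)%N | i < k].

(* #{1 <= j <= n : (x_j, ..., x_(j+k-1)) = w}; the index j of the text is the
   ordinal [j - 1] here. *)
Definition occurrences (n : nat) (x : binseq) (k : nat) (w : k.-tuple bool)
    : nat :=
  #|[set j : 'I_n | window x j k == w]|.

Section laws.
Context {R : realType}.
Implicit Types (p a s : R) (u v : R^nat).

Definition word_pmf p (k : nat) (w : k.-tuple bool) : R :=
  \prod_(i < k) bernoulli_pmf p (tnth w i).

(* Probability of the event A under Ber(p)^k. *)
Definition word_prob p (k : nat) (A : pred (k.-tuple bool)) : R :=
  \sum_(w : k.-tuple bool | A w) word_pmf p w.

(* mu = Ber(p)^N: the finite-dimensional marginals of mu are the Ber(p)^k.
   There is exactly one such mu when 0 < p < 1, see
   [bernoulli_product_exists] and [bernoulli_product_unique]. *)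
Definition is_bernoulli_product p (mu : probability binseq R) : Prop :=
  forall (k : nat) (w : k.-tuple bool),
    mu [set x : binseq | window x 0 k = w] = (word_pmf p w)%:E.

Definition log_base (b a : R) : R := ln a / ln b.

Definition binary_entropy p : R :=
  - p * log_base 2 p - (1 - p) * log_base 2 (1 - p).

Definition Phi s : R :=
  (Num.sqrt (2 * pi))^-1 *
  \int[lebesgue_measure]_(t in `]-oo, s]) expR (- t ^+ 2 / 2).

(* The scale 2^(k H(p)) a^(sqrt k). *)
Definition scale p a : R^nat :=
  fun k => 2 `^ (k%:R * binary_entropy p) * a `^ (Num.sqrt k%:R).

Definition is_o u v : Prop := u k / v k @[k --> \oo] --> (0 : R).

Definition is_omega u v : Prop := u k / v k @[k --> \oo] --> +oo.

Definition is_Theta u v : Prop :=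
  exists C1 C2 : R, [/\ 0 < C1, 0 < C2 &
    \forall k \near \oo, C1 <= u k / v k <= C2].

Lemma Phi_normal_prob s : (Phi s)%:E = normal_prob 0 1 `]-oo, s].
Proof.
have E t : normal_pdf (0 : R) 1 t =
    (Num.sqrt (2 * pi))^-1 * expR (- t ^+ 2 / 2).
  rewrite normal_pdfE ?oner_eq0// /normal_peak /normal_fun subr0 expr1n mul1r.
  by rewrite -[pi *+ 2]mulr_natl.
have c0 : (Num.sqrt (2 * pi) : R) != 0.
  by rewrite gt_eqF// sqrtr_gt0 mulr_gt0// pi_gt0.
have mI : @measurable _ (measurableTypeR R) `]-oo, s].
  exact: measurable_itv.
have I : lebesgue_measure.-integrable `]-oo, s]
    (EFin \o (fun t : R => expR (- t ^+ 2 / 2))).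
  have h : lebesgue_measure.-integrable `]-oo, s]
      (fun t : R => (normal_pdf 0 1 t)%:E).
    exact: integrableS (integrable_normal_pdf 0 1).
  have := integrableZl mI (Num.sqrt (2 * pi)) h.
  rewrite (_ : (fun _ => _) = EFin \o (fun t : R => expR (- t ^+ 2 / 2)))//.
  by apply/funext => t /=; rewrite E -EFinM mulrA mulfV ?mul1r.
rewrite /Phi /normal_prob EFinM /Rintegral fineK; last first.
  exact: integrable_fin_num.
by rewrite -integralZl//; apply: eq_integral => t _; rewrite E -EFinM.
Qed.

End laws.

Lemma coord_measurable i (B : set bool) : measurable [set x : binseq | B (x i)].
Proof. by apply: sub_sigma_algebra; exists i, B. Qed.

Lemma window_bigcup j k (P : set (k.-tuple bool)) :
  [set x : binseq | P (window x j k)] =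
  \bigcup_(w in P) [set x | window x j k = w].
Proof.
apply/seteqP; split => [x Px|x [w Pw /= xw]] /=; last by rewrite xw.
by exists (window x j k).
Qed.

Lemma cylinder_measurable j k (w : k.-tuple bool) :
  measurable [set x : binseq | window x j k = w].
Proof.
have -> : [set x : binseq | window x j k = w] =
    \bigcap_(i in [set: 'I_k]) [set x : binseq | [set tnth w i] (x (j + i)%N)].
  apply/seteqP; split => [x /= <- i _ /=|x xw /=].
    by rewrite tnth_mktuple.
  by apply: eq_from_tnth => i; rewrite tnth_mktuple; exact: xw.
apply: fin_bigcap_measurable; first exact: finite_finset.
by move=> i _; exact: coord_measurable.
Qed.

Lemma window_measurable j k (P : set (k.-tuple bool)) :
  measurable [set x : binseq | P (window x j k)].
Proof.
rewrite window_bigcup; apply: fin_bigcup_measurable; first exact: finite_finset.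
by move=> w _; exact: cylinder_measurable.
Qed.

Section uniqueness.

(* Events depending on finitely many coordinates. *)
Let fin_dim : set (set binseq) :=
  [set A | exists k (P : set (k.-tuple bool)), A = [set x | P (window x 0 k)]].

Let fin_dim_widen k l (P : set (k.-tuple bool)) : (k <= l)%N ->
  exists Q : set (l.-tuple bool),
    [set x : binseq | P (window x 0 k)] = [set x | Q (window x 0 l)].
Proof.
move=> kl.
pose f (w : l.-tuple bool) := [tuple tnth w (widen_ord kl i) | i < k].
have E (x : binseq) : window x 0 k = f (window x 0 l).
  by apply: eq_from_tnth => i; rewrite !tnth_mktuple.
by exists (P \o f); apply/seteqP; split => x /=; rewrite E.
Qed.

Let fin_dim_setI : setI_closed fin_dim.
Proof.
move=> _ _ [k [P ->]] [l [Q ->]].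
have [P' ->] := fin_dim_widen P (leq_maxl k l).
have [Q' ->] := fin_dim_widen Q (leq_maxr k l).
by exists (maxn k l), (P' `&` Q').
Qed.

Let fin_dim_generates : @measurable _ binseq = <<s fin_dim >>.
Proof.
apply/seteqP; split; last first.
  apply: smallest_sub; first exact: sigma_algebra_measurable.
  by move=> _ [k [P ->]]; exact: window_measurable.
apply: sub_sigma_algebra2 => _ [i [B ->]].
exists i.+1, [set w | B (tnth w ord_max)].
by apply/seteqP; split => x /=; rewrite tnth_mktuple.
Qed.

Lemma bernoulli_product_unique (R : realType) (p : R)
    (mu nu : probability binseq R) :
  is_bernoulli_product p mu -> is_bernoulli_product p nu ->
  forall A, measurable A -> mu A = nu A.
Proof.
move=> hmu hnu A mA.
apply: (measure_unique fin_dim (fun=> setT)) => //.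
- by move=> _; exists 0%N, setT.
- exact: bigcup_const.
- move=> _ [k [P ->]]; rewrite window_bigcup.
  have tP : trivIset P (fun w => [set x : binseq | window x 0 k = w]).
    by move=> w w' _ _ [x [/= <- <-]].
  have mP w : P w -> measurable [set x : binseq | window x 0 k = w].
    by move=> _; exact: cylinder_measurable.
  rewrite !measure_fin_bigcup//; try exact: finite_finset.
  by apply: eq_fsbigr => w _; exact: etrans (hmu k w) (esym (hnu k w)).
- by move=> _; rewrite -ge0_fin_numE ?measure_ge0// fin_num_measure.
Qed.

End uniqueness.

(* Ber(p)^N is the law of the base-(p, 1 - p) digits of a uniform point of
   [0, 1[. *)
Section existence.
Context {R : realType} (p : R) (p01 : 0 < p < 1).

Let shift (u : R) : R := if u < p then u / p else (u - p) / (1 - p).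

Let digits (u : R) : binseq := fun i => iter i shift u < p.

Let p_gt0 : 0 < p. Proof. by case/andP: p01. Qed.

Let p_lt1 : p < 1. Proof. by case/andP: p01. Qed.

Let q_gt0 : 0 < 1 - p. Proof. by rewrite subr_gt0; case/andP: p01. Qed.

Let digitsS u i : digits u i.+1 = digits (shift u) i.
Proof. by rewrite /digits iterSr. Qed.

(* The points of [0, 1[ whose digits start with s form [lo s, lo s + len s[. *)
Let lo := foldr
  (fun (c : bool) (a : R) => if c then p * a else p + (1 - p) * a) 0.

Let len := foldr (fun (c : bool) (b : R) => bernoulli_pmf p c * b) 1.

Let lo_len s : [/\ 0 <= lo s, 0 <= len s & lo s + len s <= 1].
Proof.
rewrite /len /bernoulli_pmf; elim: s => [|[] s [l0 n0 ln1]] /=.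
- by rewrite add0r.
- split; [by rewrite mulr_ge0// ltW|by rewrite mulr_ge0// ltW|].
  by rewrite -mulrDr (le_trans _ (ltW p_lt1))// ler_piMr// ltW.
- split; [by rewrite addr_ge0 ?mulr_ge0// ltW|by rewrite mulr_ge0// ltW|].
  by rewrite -addrA -mulrDr -lerBrDl ler_piMr// ltW.
Qed.

Let starts s (u : R) : bool :=
  (0 <= u < 1) && (mkseq (digits u) (size s) == s).

Let starts_itv s u : starts s u = (lo s <= u < lo s + len s).
Proof.
rewrite /starts; elim: s u => [|c s IHs] u; first by rewrite /= andbT add0r.
have -> : mkseq (digits u) (size (c :: s)) =
    (u < p) :: mkseq (digits (shift u)) (size s).
  rewrite /mkseq /= -[1%N]addn0 iotaDl -map_comp; congr (_ :: _).
  by apply: eq_map => i /=; rewrite add1n digitsS.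
rewrite eqseq_cons /len /bernoulli_pmf /= -/len; have [l0 n0 ln1] := lo_len s.
case: c => /=; rewrite ?eqb_id ?eqbF_neg.
  rewrite [RHS](_ : _ = (u < p) && (lo s <= u / p < lo s + len s)); last first.
    rewrite ler_pdivlMr// ltr_pdivrMr// mulrC mulrDl ![_ * p]mulrC.
    rewrite -mulrDr.
    have : p * (lo s + len s) <= p by rewrite ler_piMr// ltW.
    case: (ltP u p) => //= up h.
    apply/negbTE/negP => /andP[_ uh].
    by have := lt_le_trans uh h; rewrite ltNge up.
  rewrite -IHs /shift; case: (ltP u p) => up /=; last by rewrite andbF.
  rewrite pmulr_lge0 ?invr_gt0// ltr_pdivrMr// mul1r up.
  by rewrite (lt_trans up).
rewrite [RHS](_ : _ = (p <= u) &&
    (lo s <= (u - p) / (1 - p) < lo s + len s)); last first.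
  rewrite ler_pdivlMr// ltr_pdivrMr// lerBrDl ltrBlDl ![_ * (1 - p)]mulrC.
  rewrite -[in LHS]addrA -mulrDr.
  case: (leP p u) => //= up; apply/negbTE/negP => /andP[h _].
  have : p <= p + (1 - p) * lo s by rewrite lerDl mulr_ge0// ltW.
  by move=> /le_trans/(_ h); rewrite leNgt up.
rewrite -IHs /shift; case: (ltP u p) => up /=; first by rewrite andbF.
rewrite pmulr_lge0 ?invr_gt0// subr_ge0 up ltr_pdivrMr// mul1r.
by rewrite ltrD2r (le_trans _ up) ?ltW.
Qed.

Let measurable_shift : measurable_fun [set: R] shift.
Proof.
apply: measurable_fun_if => //=.
- exact: measurable_fun_ltr.
- by apply: measurable_funTS; exact: measurable_funM.
- apply: measurable_funTS; apply: measurable_funM => //.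
  exact: measurable_funB.
Qed.

Let measurable_digits : @measurable_fun _ _ (measurableTypeR R) _ setT digits.
Proof.
apply: (@measurability _ _ _ binseq _ _ coord_sets erefl).
move=> _ [_ [i [B ->]] <-]; rewrite setTI.
have mi : measurable_fun [set: R] (iter i shift).
  elim: i => [|i IHi] /=; first exact: measurable_id.
  exact: measurableT_comp measurable_shift IHi.
have mb : measurable_fun [set: R] (fun u => iter i shift u < p).
  exact: measurable_fun_ltr.
by rewrite -[X in measurable X]setTI; exact: mb.
Qed.

Definition unif01 := mrestr (@lebesgue_measure R) (measurable_itv `[0, 1[).

Let unifT : unif01 [set: R] = 1%E.
Proof.
rewrite /unif01 /mrestr setTI lebesgue_measure_itv /= lte_fin ltr01.
by rewrite oppr0 adde0.
Qed.

HB.instance Definition _ := Measure.on unif01.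
HB.instance Definition _ := Measure_isProbability.Build _ _ _ unif01 unifT.

Let digitsM : {mfun measurableTypeR R >-> binseq} :=
  @mfun_Sub _ _ (measurableTypeR R) binseq digits (mem_set measurable_digits).

Let lenE k (w : k.-tuple bool) : len w = word_pmf p w.
Proof.
elim: k w => [|k IHk] w; first by rewrite tuple0 /word_pmf big_ord0.
case/tupleP: w => c w; rewrite /word_pmf big_ord_recl tnth0 /= IHk.
by congr (_ * _); apply: eq_bigr => i _; rewrite tnthS.
Qed.

Lemma bernoulli_product_exists :
  exists mu : probability binseq R, is_bernoulli_product p mu.
Proof.
exists (@distribution _ _ (measurableTypeR R) binseq R unif01 digitsM) => k w.
have pre (u : R) : (window (digits u) 0 k == w) =
    (mkseq (digits u) (size w) == w).
  rewrite size_tuple -val_eqE /= /mkseq -val_enum_ord -map_comp.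
  by congr (_ == _); apply: eq_map.
transitivity (lebesgue_measure (`[lo w, lo w + len w[%classic : set R)).
  congr (lebesgue_measure _).
  apply/seteqP; split => u /=; rewrite !in_itv /= -starts_itv /starts.
    by move=> [/eqP uw ->]; rewrite -pre.
  by move=> /andP[-> uw]; split => //; apply/eqP; rewrite pre.
rewrite lebesgue_measure_itv /= lte_fin ltrDl.
have [_ n0 _] := lo_len w.
case: ltP => [_|n0']; last by rewrite -lenE (@le_anti _ _ (len w) 0) ?n0 ?n0'.
by rewrite -EFinB addrAC subrr add0r lenE.
Qed.

End existence.

(* Main.v *)
Require Import Defs.
From mathcomp Require Import all_boot all_order all_algebra.
From mathcomp Require Import all_classical all_reals all_analysis.
From mathcomp Require Import measurable_realfun.
From mathcomp Require Import ring lra zify.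
Import Order.TTheory GRing.Theory Num.Theory.
Import numFieldNormedType.Exports.
Local Open Scope classical_set_scope.
Local Open Scope ring_scope.
Set Implicit Arguments.
Unset Strict Implicit.
Unset Printing Implicit Defensive.

(** For a fixed word w the number of its occurrences among the first N_k windows
    of x has mean lambda(w) = N_k P(w), and, since disjoint windows are
    independent, variance at most 2 k lambda(w). So w is unlikely to occur when
    lambda(w) <= k^-4 and likely to occur at least k times when
    lambda(w) > k^6; by Markov's inequality and Borel-Cantelli, for almost every
    x the exceptional words have probability at most k^-2 for all large k.

    With W the standardized number of ones of w,
    lambda(w) = exp (sqrt k (beta_k + rho sigma W)) where
    N_k = 2^(k H(p)) exp (beta_k sqrt k), rho = ln (p / (1 - p)) and
    sigma^2 = p (1 - p). Polynomial factors are exp (o (sqrt k)), so both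
    thresholds amount to W <= t_k with t_k having the limit of
    - beta_k / (rho sigma), and the de Moivre-Laplace theorem concludes.

    The latter follows from Stein's method: the binomial law satisfies an exact
    discrete version of E[W f(W)] = E[f'(W)], and every compactly supported
    continuous function with Gaussian mean 0 has the form f'(x) - x f(x) with f
    compactly supported. *)

(** * Finite Bernoulli words *)

Section word_expectation.
Context {R : realType} (p : R).
Implicit Types (k m n : nat).

Definition word_exp k (f : k.-tuple bool -> R) : R :=
  \sum_(w : k.-tuple bool) word_pmf p w * f w.

Lemma word_probE k (A : pred (k.-tuple bool)) :
  word_prob p A = word_exp (fun w => (A w)%:R).
Proof.
rewrite /word_prob /word_exp big_mkcond; apply: eq_bigr => w _.
by case: (A w); rewrite ?mulr1 ?mulr0.
Qed.

Lemma word_exp0 (f : 0.-tuple bool -> R) : word_exp f = f [tuple].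
Proof.
rewrite /word_exp (big_pred1 [tuple]); last first.
  by move=> w; apply/esym/eqP/val_inj; case: w => -[].
by rewrite /word_pmf big_ord0 mul1r.
Qed.

Lemma word_expS k (f : k.+1.-tuple bool -> R) :
  word_exp f = p * word_exp (fun w => f (cons_tuple true w)) +
    (1 - p) * word_exp (fun w => f (cons_tuple false w)).
Proof.
rewrite /word_exp.
rewrite (reindex (fun bw : bool * k.-tuple bool => cons_tuple bw.1 bw.2)) /=; last first.
  exists (fun w => (thead w, [tuple of behead w])) => [[b w] _|w _] /=.
    by congr (_, _); apply: val_inj.
  by case/tupleP: w => b w; apply: val_inj.
rewrite -(pair_bigA _ (fun b w => word_pmf p (cons_tuple b w) * f (cons_tuple b w))) /=.
rewrite big_bool !mulr_sumr; congr (_ + _); apply: eq_bigr => w _;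
  rewrite mulrA; congr (_ * _);
  rewrite /word_pmf big_ord_recl tnth0; congr (_ * _);
  by apply: eq_bigr => i _; rewrite tnthS.
Qed.

Lemma word_expD k (f g : k.-tuple bool -> R) :
  word_exp (fun w => f w + g w) = word_exp f + word_exp g.
Proof. by rewrite /word_exp -big_split; apply: eq_bigr => w _; rewrite mulrDr. Qed.

Lemma word_expZ k c (f : k.-tuple bool -> R) :
  word_exp (fun w => c * f w) = c * word_exp f.
Proof. by rewrite /word_exp mulr_sumr; apply: eq_bigr => w _; rewrite mulrCA. Qed.

Lemma word_expB k (f g : k.-tuple bool -> R) :
  word_exp (fun w => f w - g w) = word_exp f - word_exp g.
Proof.
by rewrite /word_exp -sumrB; apply: eq_bigr => w _; rewrite mulrBr.
Qed.

Lemma word_exp_sum k I (r : seq I) (P : pred I) (f : I -> k.-tuple bool -> R) :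
  word_exp (fun w => \sum_(i <- r | P i) f i w) =
  \sum_(i <- r | P i) word_exp (f i).
Proof.
rewrite /word_exp exchange_big; apply: eq_bigr => w _; by rewrite mulr_sumr.
Qed.

Lemma eq_word_exp k (f g : k.-tuple bool -> R) : f =1 g -> word_exp f = word_exp g.
Proof. by move=> fg; apply: eq_bigr => w _; rewrite fg. Qed.

Lemma word_exp_cst k c : word_exp (fun _ : k.-tuple bool => c) = c.
Proof.
elim: k => [|k IH]; first by rewrite word_exp0.
by rewrite word_expS !IH -mulrDl subrKC mul1r.
Qed.

Hypothesis p01 : 0 <= p <= 1.

Lemma word_pmf_ge0 k (w : k.-tuple bool) : 0 <= word_pmf p w.
Proof. by apply: prodr_ge0 => i _; exact: bernoulli_pmf_ge0. Qed.

Lemma ler_word_exp k (f g : k.-tuple bool -> R) :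
  (forall w, f w <= g w) -> word_exp f <= word_exp g.
Proof.
by move=> fg; apply: ler_sum => w _; apply: ler_wpM2l => //; exact: word_pmf_ge0.
Qed.

Lemma word_exp_ge0 k (f : k.-tuple bool -> R) : (forall w, 0 <= f w) -> 0 <= word_exp f.
Proof. by move=> f0; apply: sumr_ge0 => w _; rewrite mulr_ge0// word_pmf_ge0. Qed.

Lemma ler_norm_word_exp k (f : k.-tuple bool -> R) :
  `|word_exp f| <= word_exp (fun w => `|f w|).
Proof.
apply: (le_trans (ler_norm_sum _ _ _)); apply: ler_sum => w _.
by rewrite normrM ger0_norm// word_pmf_ge0.
Qed.

Lemma word_prob_ge0 k (A : pred (k.-tuple bool)) : 0 <= word_prob p A.
Proof. by rewrite word_probE; apply: word_exp_ge0 => w. Qed.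

Lemma le_word_prob k (A B : pred (k.-tuple bool)) :
  (forall w, A w -> B w) -> word_prob p A <= word_prob p B.
Proof.
move=> AB; rewrite !word_probE; apply: ler_word_exp => w; rewrite ler_nat.
by case: (A w) (AB w) => // ->.
Qed.

Lemma word_prob_le1 k (A : pred (k.-tuple bool)) : word_prob p A <= 1.
Proof.
rewrite word_probE -[leRHS](@word_exp_cst k 1); apply: ler_word_exp => w.
by rewrite lern1 leq_b1.
Qed.

Lemma word_probC k (A : pred (k.-tuple bool)) :
  word_prob p (predC A) = 1 - word_prob p A.
Proof.
rewrite !word_probE -[X in X - _](@word_exp_cst k 1) -word_expB.
by apply: eq_word_exp => w /=; case: (A w); rewrite ?subrr ?subr0.
Qed.

Lemma word_probU k (A B : pred (k.-tuple bool)) :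
  word_prob p (predU A B) <= word_prob p A + word_prob p B.
Proof.
rewrite !word_probE -word_expD; apply: ler_word_exp => w /=.
by rewrite -natrD ler_nat; case: (A w); case: (B w).
Qed.

(** Independence of the letters: the mean of a product of one-letter factors factorizes. The factors
    are indexed by [nat], so that the induction can shift them past the first letter. *)
Lemma word_exp_prod m (c : nat -> bool -> R) :
  word_exp (fun v : m.-tuple bool => \prod_(i < m) c i (nth false v i)) =
  \prod_(i < m) (p * c i true + (1 - p) * c i false).
Proof.
elim: m c => [|m IH] c; first by rewrite word_exp0 !big_ord0.
rewrite word_expS big_ord_recl [RHS]mulrDl.
have E b : word_exp (fun w : m.-tuple bool =>
    \prod_(i < m.+1) c i (nth false (cons_tuple b w) i)) =
   c 0%N b * \prod_(i < m) (p * c i.+1 true + (1 - p) * c i.+1 false).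
  rewrite -(IH (fun i => c i.+1)) -word_expZ. apply: eq_word_exp => w.
  by rewrite big_ord_recl.
rewrite !E !mulrA; congr (_ + _).
Qed.

End word_expectation.

(** * Mean and variance of occurrence counts *)

Section occurrences.
Context {R : realType} (p : R).
Implicit Types (k m n : nat).

(** Turns a finite random word into a sequence, to which [window] and [occurrences] apply. The added
    letters [false] are harmless as long as all windows in question end inside the word. *)
Definition pad (v : seq bool) : binseq := nth false v.

(** The factor contributed by coordinate i to the indicator that the window at j spells w;
    coordinates outside the window contribute 1. This puts the indicator in the form required by
    [word_exp_prod]. *)
Let ind k (w : k.-tuple bool) j (i : nat) (b : bool) : R :=
  if (j <= i < j + k)%N then (b == nth false w (i - j))%:R else 1.

Let indP m k (w : k.-tuple bool) j (v : m.-tuple bool) : (j + k <= m)%N ->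
  (window (pad v) j k == w)%:R = \prod_(i < m) ind w j i (nth false v i) :> R.
Proof.
move=> jkm; case: eqP => [<-|nw].
  rewrite big1// => i _; rewrite /ind; case: ifP => // /andP[ji ijk].
  have lt : (i - j < k)%N by rewrite ltn_subLR.
  rewrite -[(i - j)%N]/(val (Ordinal lt)).
  rewrite -(tnth_nth false (window (pad v) j k)) tnth_mktuple /=.
  by rewrite /pad subnKC// eqxx.
(* A single mismatched letter t makes the factor at coordinate j + t vanish, hence the whole
   product. *)
have [t wt] : exists t : 'I_k, tnth (window (pad v) j k) t != tnth w t.
  apply/not_existsP => h; apply: nw; apply: eq_from_tnth => t.
  by apply/eqP; move/negP: (h t); rewrite negbK.
have lt : (j + t < m)%N by rewrite (leq_trans _ jkm)// ltn_add2l.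
rewrite (bigD1 (Ordinal lt))//= /ind leq_addr ltn_add2l ltn_ord /=.
rewrite addKn; rewrite tnth_mktuple (tnth_nth false) /pad in wt.
by rewrite (negbTE wt) mul0r.
Qed.

Let ind_mean k (w : k.-tuple bool) j i :
  p * ind w j i true + (1 - p) * ind w j i false =
  if (j <= i < j + k)%N then bernoulli_pmf p (nth false w (i - j)) else 1.
Proof.
rewrite /ind /bernoulli_pmf; case: ifP => _; last by rewrite !mulr1 subrKC.
by case: nth => /=; rewrite ?mulr1 ?mulr0 ?addr0 ?add0r.
Qed.

Let ind_prod m k (w : k.-tuple bool) j : (j + k <= m)%N ->
  \prod_(i < m) (p * ind w j i true + (1 - p) * ind w j i false) = word_pmf p w.
Proof.
move=> jkm; under eq_bigr do rewrite ind_mean.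
rewrite -(big_mkord xpredT (fun i => if (j <= i < j + k)%N then
  bernoulli_pmf p (nth false w (i - j)) else 1)).
rewrite (big_cat_nat (n := j)) ?leq0n //=; last first.
  by rewrite (leq_trans _ jkm)// leq_addr.
rewrite big_nat_cond big1 ?mul1r; last by move=> i; case: ifP => //; lia.
rewrite (big_cat_nat (n := j + k))%N ?leq_addr//=.
rewrite [X in _ * X]big_nat_cond [X in _ * X]big1 ?mulr1; last first.
  by move=> i; case: ifP => //; lia.
rewrite (eq_big_nat _ _
  (F2 := fun i => bernoulli_pmf p (nth false w (i - j)))); last first.
  by move=> i ->.
rewrite -{1}[j]add0n big_addn addKn big_mkord /word_pmf.
by apply: eq_bigr => i _; rewrite addnK (tnth_nth false).
Qed.

Lemma word_exp_window m k (w : k.-tuple bool) j : (j + k <= m)%N ->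
  word_exp p (fun v : m.-tuple bool => (window (pad v) j k == w)%:R) =
  word_pmf p w.
Proof.
move=> jkm; rewrite -(ind_prod w jkm) -word_exp_prod.
by apply: eq_word_exp => v; rewrite indP.
Qed.

(** Disjoint windows are independent: at each coordinate at most one of the two factors differs from
    1, so the mean of their product is the product of their means. *)
Lemma word_exp_window2 m k (w : k.-tuple bool) j j' :
  (j + k <= m)%N -> (j' + k <= m)%N -> (j + k <= j')%N || (j' + k <= j)%N ->
  word_exp p (fun v : m.-tuple bool =>
    (window (pad v) j k == w)%:R * (window (pad v) j' k == w)%:R) =
  word_pmf p w ^+ 2.
Proof.
move=> jkm jkm' jj'; rewrite expr2 -{1}(ind_prod w jkm) -(ind_prod w jkm').
rewrite -big_split /=.
transitivity (\prod_(i < m) (p * (ind w j i true * ind w j' i true) +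
    (1 - p) * (ind w j i false * ind w j' i false))).
  rewrite -(word_exp_prod p m (fun i b => ind w j i b * ind w j' i b)).
  by apply: eq_word_exp => v; rewrite !indP// big_split.
apply: eq_bigr => i _; rewrite !ind_mean /ind.
case: ifP => h1; case: ifP => h2; rewrite ?mulr1 ?mul1r ?subrKC//.
- by exfalso; move: h1 h2 jj'; lia.
- by rewrite /bernoulli_pmf; case: nth => /=; rewrite ?mulr1 ?mulr0 ?addr0 ?add0r.
- by rewrite /bernoulli_pmf; case: nth => /=; rewrite ?mulr1 ?mulr0 ?addr0 ?add0r.
Qed.

Lemma occurrences_card n (x : binseq) k (w : k.-tuple bool) :
  occurrences n x w = #|[pred j : 'I_n | window x j k == w]|.
Proof.
apply: eq_card => j; rewrite [RHS]inE.
by apply/idP/idP => [/set_mem//|h]; exact/mem_set.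
Qed.

Lemma occurrencesE n (x : binseq) k (w : k.-tuple bool) :
  (occurrences n x w)%:R = \sum_(j < n) (window x j k == w)%:R :> R.
Proof.
rewrite occurrences_card -sum1_card natr_sum /= big_mkcond /=.
by apply: eq_bigr => j _; rewrite inE; case: eqP.
Qed.

(** Reduces statements about a sequence to statements about its first m letters, whose law is
    [word_pmf]. *)
Lemma occurrences_window m n (x : binseq) k (w : k.-tuple bool) : (n + k <= m)%N ->
  occurrences n (pad (window x 0 m)) w = occurrences n x w.
Proof.
move=> nkm; rewrite !occurrences_card; apply: eq_card => j; rewrite !inE.
congr (_ == _).
apply: eq_from_tnth => i; rewrite !tnth_mktuple /pad.
have lt : (j + i < m)%N by have := ltn_ord i; have := ltn_ord j; lia.
by rewrite -[(j + i)%N]/(val (Ordinal lt)) -tnth_nth tnth_mktuple.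
Qed.

Lemma word_exp_occurrences m n k (w : k.-tuple bool) : (n + k <= m)%N ->
  word_exp p (fun v : m.-tuple bool => (occurrences n (pad v) w)%:R) =
  n%:R * word_pmf p w.
Proof.
move=> nkm; under [LHS]eq_word_exp do rewrite occurrencesE.
rewrite word_exp_sum (eq_bigr (fun _ => word_pmf p w)); last first.
  by move=> j _; rewrite word_exp_window//; have := ltn_ord j; lia.
by rewrite sumr_const card_ord mulr_natl.
Qed.

Hypothesis p01 : 0 <= p <= 1.

(** These i are the starts of the windows that overlap the one at j. The map sending i to i + k - j
    embeds them into the integers below 2k; the case k = 0 is separate because [inord] needs a
    nonempty target. *)
Lemma card_near n k (j : 'I_n) :
  (#|[pred i : 'I_n | (j < i + k) && (i < j + k)]| <= 2 * k)%N.
Proof.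
have h (i : 'I_n) : (j < i + k)%N && (i < j + k)%N -> (i + k - j < 2 * k)%N by lia.
case: k h => [|k] h.
  by rewrite leqn0; apply/eqP/eq_card0 => i; rewrite !inE; lia.
have e2 : (2 * k.+1 = k.*2.+2)%N by rewrite mul2n.
rewrite e2 in h *; rewrite -[leqRHS]card_ord.
rewrite -(@card_in_image _ 'I_k.*2.+2
  (fun i : 'I_n => inord (i + k.+1 - j))) ?max_card//.
move=> a b; rewrite !inE => ha hb /(congr1 val) /=.
rewrite !inordK; [|exact: h|exact: h]; move=> e; apply: val_inj => /=; lia.
Qed.

(** The second moment is a sum over pairs of windows. A disjoint pair contributes P(w)^2, as in the
    squared mean. An overlapping pair contributes at most P(w), and each window belongs to at most
    2k of these. *)
Lemma word_var_occurrences m n k (w : k.-tuple bool) : (n + k <= m)%N ->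
  word_exp p (fun v : m.-tuple bool =>
    ((occurrences n (pad v) w)%:R - n%:R * word_pmf p w) ^+ 2) <=
  (2 * k)%:R * (n%:R * word_pmf p w).
Proof.
move=> nkm; set lam := n%:R * _.
have w0 := word_pmf_ge0 p01 w.
have -> : word_exp p (fun v : m.-tuple bool =>
    ((occurrences n (pad v) w)%:R - lam) ^+ 2) =
  word_exp p (fun v : m.-tuple bool => ((occurrences n (pad v) w)%:R) ^+ 2) - lam ^+ 2.
  under [LHS]eq_word_exp => v do rewrite sqrrB.
  rewrite word_expD word_expB word_exp_cst.
  under [X in _ - X + _]eq_word_exp => v do rewrite -mulr_natl mulrA mulrC mulrA.
  by rewrite word_expZ word_exp_occurrences// -/lam; ring.
rewrite lerBlDr.
have -> : word_exp p (fun v : m.-tuple bool => ((occurrences n (pad v) w)%:R) ^+ 2) =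
  \sum_(j < n) \sum_(i < n) word_exp p (fun v : m.-tuple bool =>
    (window (pad v) j k == w)%:R * (window (pad v) i k == w)%:R).
  rewrite -[RHS](eq_bigr _ (fun j _ => word_exp_sum _ _ _ _)) -word_exp_sum.
  apply: eq_word_exp => v; rewrite occurrencesE expr2 mulr_suml.
  by apply: eq_bigr => j _; rewrite mulr_sumr.
have -> : (2 * k)%:R * lam + lam ^+ 2 =
  \sum_(j < n) ((2 * k)%:R * word_pmf p w + \sum_(i < n) word_pmf p w ^+ 2).
  rewrite big_split /= !sumr_const card_ord /lam natrM; ring.
apply: ler_sum => j _.
apply: (@le_trans _ _ (\sum_(i < n) (((j < i + k) && (i < j + k))%N%:R * word_pmf p w
    + word_pmf p w ^+ 2))); last first.
  rewrite big_split /= lerD2r -mulr_suml ler_wpM2r// -natr_sum ler_nat.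
  by rewrite -big_mkcond sum1_card card_near.
apply: ler_sum => i _; have := ltn_ord i; have := ltn_ord j => jn in_.
case: (boolP ((j < i + k) && (i < j + k))%N) => h; last first.
  by rewrite mul0r add0r word_exp_window2//; lia.
rewrite mul1r -[leLHS]addr0 lerD ?sqr_ge0//.
rewrite -[leRHS](@word_exp_window m k w j); last lia.
by apply: ler_word_exp => // v; case: eqP; case: eqP; rewrite ?mulr1 ?mulr0 ?mul0r.
Qed.

End occurrences.

(** * Exceptional words and the Borel-Cantelli argument *)

Section mismatch.
Context {R : realType} (p : R).
Implicit Types (k m n : nat).

(** The exceptional words: rare ones that occur, and frequent ones that occur too seldom. Asking for
    k occurrences rather than a fixed number lets one event serve all n at once. Words whose mean
    lies between the thresholds are never exceptional. *)
Definition mismatch n (x : binseq) k (w : k.-tuple bool) : bool :=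
  (n%:R * word_pmf p w <= k%:R ^- 4) && (0 < occurrences n x w)%N ||
  (k%:R ^+ 6 < n%:R * word_pmf p w) && (occurrences n x w < k)%N.

Hypothesis p01 : 0 <= p <= 1.

Lemma word_prob_mismatch_window m n k (x : binseq) : (n + k <= m)%N ->
  word_prob p (mismatch n (pad (window x 0 m)) (k := k)) =
  word_prob p (mismatch n x (k := k)).
Proof.
move=> nkm; rewrite /word_prob; apply: eq_bigl => w.
by rewrite /mismatch occurrences_window.
Qed.

(** Below the lower threshold, Markov's inequality bounds the probability of an occurrence by the
    mean. Above the upper one, fewer than k occurrences means a deviation of at least half the mean,
    and Chebyshev's inequality gives 8 k / lambda. *)
Lemma word_exp_mismatch m n k (w : k.-tuple bool) : (n + k <= m)%N -> (1 < k)%N ->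
  word_exp p (fun v : m.-tuple bool => (mismatch n (pad v) w)%:R) <= 8 * k%:R ^- 4.
Proof.
move=> nkm k2; set lam := n%:R * word_pmf p w.
have lam0 : 0 <= lam by rewrite mulr_ge0// word_pmf_ge0.
have kR : 2 <= k%:R :> R by rewrite ler_nat.
have k4 : 0 < k%:R ^- 4 :> R by rewrite invr_gt0 exprn_gt0// ltr0n ltnW.
have k41 : k%:R ^- 4 <= 1 :> R by rewrite invf_le1 ?exprn_gt0 ?exprn_ege1//; lra.
have k61 : 1 <= k%:R ^+ 6 :> R by rewrite exprn_ege1//; lra.
rewrite /mismatch -/lam; have [le4|gt4] := leP lam (k%:R ^- 4).
  rewrite ltNge (le_trans le4 (le_trans k41 k61)) /=.
  apply: (@le_trans _ _ lam); last by lra.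
  rewrite /lam -(word_exp_occurrences p w nkm); apply: ler_word_exp => // v.
  by rewrite orbF ler_nat; case: occurrences.
have [gt6|_] := ltP; last by rewrite word_exp_cst mulr_ge0// ltW.
(* Since k >= 2, this gives lambda > k^6 >= 2k, so a count of at most k is at most lambda / 2. *)
have k32 : 32 <= k%:R ^+ 5 :> R.
  have -> : (32 = 2 ^+ 5 :> R) by ring.
  by rewrite lerXn2r// nnegrE//; lra.
have klam : 2 * k%:R <= lam.
  rewrite (le_trans _ (ltW gt6))// exprSr ler_wpM2r//; lra.
have lamp : 0 < lam by lra.
apply: (@le_trans _ _ (4 / lam ^+ 2 * ((2 * k)%:R * lam))).
  apply: le_trans (_ : _ <= word_exp p (fun v : m.-tuple bool =>
    4 / lam ^+ 2 * ((occurrences n (pad v) w)%:R - lam) ^+ 2)) _; last first.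
    rewrite word_expZ ler_wpM2l//; first by rewrite divr_ge0// exprn_ge0.
    exact: word_var_occurrences.
  apply: ler_word_exp => // v /=; case: ltnP => /= h; last first.
    by rewrite mulr_ge0 ?sqr_ge0// divr_ge0// exprn_ge0.
  have hk : (occurrences n (pad v) w)%:R <= k%:R :> R by rewrite ler_nat ltnW.
  rewrite mulrAC ler_pdivlMr ?exprn_gt0// mul1r.
  have : (lam / 2) ^+ 2 <= (lam - (occurrences n (pad v) w)%:R) ^+ 2.
    by rewrite lerXn2r ?nnegrE//; lra.
  by rewrite -(sqrrN (lam - _)) opprB; nra.
have -> : 4 / lam ^+ 2 * ((2 * k)%:R * lam) = 8 * (k%:R / lam).
  by rewrite natrM; field; lra.
rewrite ler_pM2l//; apply: (@le_trans _ _ (k%:R / k%:R ^+ 6)).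
  by rewrite ler_pM2l ?lef_pV2 ?posrE ?(ltW gt6)//; lra.
rewrite ler_pdivrMr; last by lra.
rewrite (_ : 6 = 2 + 4)%N // exprD mulrCA mulVf ?mulr1; last by rewrite expf_neq0//; lra.
by rewrite expr2 ler_peMr//; lra.
Qed.

Variables (mu : probability binseq R) (hmu : is_bernoulli_product p mu).

Lemma mu_window m (P : pred (m.-tuple bool)) :
  mu [set x : binseq | P (window x 0 m)] = (word_prob p P)%:E.
Proof.
rewrite (window_bigcup 0 [set` P]) measure_fin_bigcup//; last 2 first.
- by move=> w w' _ _ [x [/= <- <-]].
- by move=> w _; exact: cylinder_measurable.
rewrite (eq_fsbigr (fun w => (word_pmf p w)%:E)); last first.
  by move=> w _; exact: hmu.
rewrite fsumEFin; last exact: finite_finset.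
congr EFin; rewrite /word_prob.
rewrite fsbig_mkcond (fsbigE (index_enum _)) ?index_enum_uniq//; last first.
  by move=> i _; rewrite mem_index_enum.
rewrite [RHS]big_mkcond; apply: eq_big => [w|w _]; first by rewrite in_setT.
rewrite /patch; case: ifPn => [|]; first by rewrite inE /= => Pw; rewrite ifT.
by move=> h; case: ifP => // Pw; case/negP: h; rewrite inE.
Qed.

Variable N : nat -> nat.

(** Averaging over x and over w commute, so the mean over x of the probability of a mismatch is at
    most 8 k^-4; Markov's inequality at level k^-2 leaves 8 k^-2. *)
Lemma mu_mismatch k : (1 < k)%N ->
  (mu [set x : binseq | k%:R ^- 2 < word_prob p (mismatch (N k) x (k := k))]%R <=
   (8 * k%:R ^- 2)%:E)%E.
Proof.
move=> k2; have k0 : 0 < k%:R :> R by rewrite ltr0n ltnW.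
set m := (N k + k)%N.
have -> : [set x : binseq | k%:R ^- 2 < word_prob p (mismatch (N k) x (k := k))] =
  [set x : binseq | [pred v : m.-tuple bool |
     k%:R ^- 2 < word_prob p (mismatch (N k) (pad v) (k := k))] (window x 0 m)].
  by apply/funext => x /=; rewrite word_prob_mismatch_window.
rewrite mu_window lee_fin word_probE.
apply: (@le_trans _ _ (word_exp p (fun v : m.-tuple bool => k%:R ^+ 2 *
   word_exp p (fun w : k.-tuple bool => (mismatch (N k) (pad v) w)%:R)))).
  apply: ler_word_exp => // v /=; rewrite -word_probE.
  have [h|_] := ltP; last by rewrite mulr_ge0 ?exprn_ge0 ?word_prob_ge0// ltW.
  by rewrite -ler_pdivrMl ?exprn_gt0// mulr1 ltW.
rewrite word_expZ.
have -> : 8 * k%:R ^- 2 = k%:R ^+ 2 * (8 * k%:R ^- 4) :> R by field; rewrite gt_eqF.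
rewrite ler_wpM2l ?exprn_ge0 ?(ltW k0)//.
rewrite [leLHS](_ : _ = word_exp p (fun w : k.-tuple bool =>
  word_exp p (fun v : m.-tuple bool => (mismatch (N k) (pad v) w)%:R))); last first.
  rewrite /word_exp; under eq_bigr do rewrite mulr_sumr.
  rewrite exchange_big; apply: eq_bigr => w _; rewrite mulr_sumr.
  by apply: eq_bigr => v _; rewrite mulrCA.
rewrite -[leRHS](word_exp_cst p k); apply: ler_word_exp => // w.
exact: word_exp_mismatch.
Qed.

(** Borel-Cantelli: the bounds 8 k^-2 are summable by comparison with the telescoping series of
    1/(k-1) - 1/k. The events are indexed by k = n + 2 because both bounds need k > 1. *)
Lemma ae_mismatch :
  {ae mu, forall x : binseq, \forall k \near \oo,
     word_prob p (mismatch (N k) x (k := k)) <= k%:R ^- 2}.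
Proof.
pose F n := [set x : binseq |
  n.+2%:R ^- 2 < word_prob p (mismatch (N n.+2) x (k := n.+2))].
have mF n : measurable (F n).
  set m := (N n.+2 + n.+2)%N.
  rewrite (_ : F n = [set x : binseq | [set v : m.-tuple bool |
     n.+2%:R ^- 2 < word_prob p (mismatch (N n.+2) (pad v) (k := n.+2))]
       (window x 0 m)]).
    exact: window_measurable.
  by apply/funext => x /=; rewrite word_prob_mismatch_window.
have F0 : mu (lim_sup_set F) = 0%E.
  apply: lim_sup_set_cvg0 => //; apply: (@le_lt_trans _ _ 8%:E); last exact: ltry.
  apply: lime_le; first by apply: is_cvg_nneseries => *; exact: measure_ge0.
  apply: nearW => n.
  apply: (@le_trans _ _ (\sum_(0 <= i < n) (8 * (i.+1%:R^-1 - i.+2%:R^-1))%:E)%E).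
    apply: lee_sum => i _; apply: (le_trans (mu_mismatch (k := i.+2) _)) => //.
    rewrite lee_fin ler_pM2l//.
    have -> : i.+1%:R^-1 - i.+2%:R^-1 = (i.+1%:R * i.+2%:R)^-1 :> R.
      have : 0 < i.+1%:R :> R by rewrite ltr0n.
      by rewrite -[i.+2%:R]natr1; move: i.+1%:R => a a0; field; lra.
    rewrite lef_pV2 ?posrE ?mulr_gt0 ?exprn_gt0// expr2 ler_wpM2r// ler_nat //.
  rewrite sumEFin lee_fin -mulr_sumr ger_pMr//.
  rewrite (eq_bigr (fun i => - i.+2%:R^-1 - - i.+1%:R^-1)); last first.
    by move=> i _; rewrite opprK addrC.
  by rewrite (telescope_sumr (fun i => - i.+1%:R^-1 : R))// opprK invr1 gerDr oppr_le0.
exists (lim_sup_set F); split => //.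
  apply: bigcapT_measurable => n; apply: bigcup_measurable => j _; exact: mF.
move=> x /= nx n _; apply: contrapT => hn; apply: nx.
(* The bound can only fail from n + 2 on at some k = j + 2 with j >= n, which would put x in the
   n-th union of the limsup. *)
exists n.+2 => // k /= nk; rewrite leNgt; apply/negP => hk; apply: hn.
case: k nk hk => [//|[//|k]] nk hk.
by exists k.
Qed.

End mismatch.

(** * Stein's identity for the binomial law *)

Section standardized.
Context {R : realType} (p : R).
Implicit Types (k : nat) (f : R -> R).

Definition ones k (w : k.-tuple bool) : nat := count id w.

(** For the binomial weights b(j) this is the relation (1 - p) j b(j) = p (k - j + 1) b(j - 1),
    summed against g. Conditioning on the first letter and using the induction hypothesis for g and
    for its shift avoids binomial coefficients. *)
Lemma binomial_stein k (g : nat -> R) :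
  word_exp p (fun w : k.-tuple bool => (1 - p) * (ones w)%:R * g (ones w)) =
  word_exp p (fun w : k.-tuple bool => p * (k%:R - (ones w)%:R) * g (ones w).+1).
Proof.
elim: k g => [|k IH] g.
  by rewrite !word_exp0 /ones /= subrr !(mulr0, mul0r).
have IHg := IH g; have IHg1 := IH (g \o succn).
rewrite !word_expS /ones /= -/(ones _).
under [X in p * X]eq_word_exp => w do rewrite add1n -natr1 mulrDr mulr1 mulrDl.
under [X in (1 - p) * X]eq_word_exp => w do rewrite add0n.
under [X in _ = p * X + _]eq_word_exp => w do
  rewrite add1n -natr1 -[(ones w).+1%:R]natr1 opprD addrACA subrr addr0.
under [X in _ = _ + (1 - p) * X]eq_word_exp => w do
  rewrite add0n -natr1 addrAC mulrDr mulr1 mulrDl.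
rewrite !word_expD /= !word_expZ.
rewrite IHg.
have -> : word_exp p (fun w : k.-tuple bool => p * (k%:R - (ones w)%:R) * g (ones w).+2) =
  word_exp p (fun w : k.-tuple bool => (1 - p) * (ones w)%:R * g (ones w).+1).
  exact/esym/IHg1.
ring.
Qed.

Definition std k (w : k.-tuple bool) : R :=
  ((ones w)%:R - k%:R * p) / Num.sqrt (k%:R * (p * (1 - p))).

Hypothesis p01 : 0 < p < 1.

Let pq0 : 0 < p * (1 - p).
Proof. by move: p01 => /andP[p0 p1]; rewrite mulr_gt0// subr_gt0. Qed.

Let p01' : 0 <= p <= 1. Proof. by move: p01 => /andP[/ltW -> /ltW ->]. Qed.

Let s k : R := Num.sqrt (k%:R * (p * (1 - p))).

Let s_gt0 k : (0 < k)%N -> 0 < s k.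
Proof. by move=> k0; rewrite sqrtr_gt0 mulr_gt0// ltr0n. Qed.

(** [binomial_stein] rewritten in terms of W = [std w]: one more letter 1 moves W by 1/s, the number
    of ones is k p + s W, and k = s^2 / (p (1 - p)). *)
Lemma std_stein k f : (0 < k)%N ->
  word_exp p (fun w : k.-tuple bool =>
     std w * ((1 - p) * f (std w) + p * f (std w + (s k)^-1))) =
  word_exp p (fun w : k.-tuple bool => s k * (f (std w + (s k)^-1) - f (std w))).
Proof.
move=> k0; have s0 := s_gt0 k0.
have sE : s k ^+ 2 = k%:R * (p * (1 - p)) by rewrite sqr_sqrtr// mulr_ge0// ltW.
have := binomial_stein k (fun i => f ((i%:R - k%:R * p) / s k)).
move/eqP; rewrite -subr_eq0 -word_expB => /eqP h.
apply/eqP; rewrite -subr_eq0 -word_expB; apply/eqP.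
have s1 : s k != 0 by rewrite gt_eqF.
apply: (@mulfI _ (s k)) => //; rewrite mulr0 -word_expZ -[RHS]h.
apply: eq_word_exp => w; set W := std w.
have -> : ((ones w)%:R - k%:R * p) / s k = W by [].
have -> : ((ones w).+1%:R - k%:R * p) / s k = W + (s k)^-1.
  by rewrite /W /std -/(s k) -natr1; field.
have -> : (ones w)%:R = k%:R * p + s k * W.
  by rewrite /W /std -/(s k) [s k * _]mulrC divfK// addrC subrK.
have -> : k%:R = s k ^+ 2 / (p * (1 - p)) by rewrite sE mulfK// gt_eqF.
by field; move: p01; lra.
Qed.

(** The first two moments of W are read off from [std_stein] with f constant and then with f the
    identity. *)
Lemma word_exp_std k : (0 < k)%N -> word_exp p (fun w : k.-tuple bool => std w) = 0.
Proof.
move=> k0; have := std_stein (fun=> 1) k0.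
under eq_word_exp do rewrite !mulr1 subrK mulr1.
by under [RHS]eq_word_exp do rewrite subrr mulr0; rewrite word_exp_cst.
Qed.

Lemma word_exp_std2 k : (0 < k)%N ->
  word_exp p (fun w : k.-tuple bool => std w ^+ 2) = 1.
Proof.
move=> k0; have := std_stein id k0.
under [RHS]eq_word_exp do rewrite addrAC subrr add0r mulfV ?gt_eqF ?s_gt0//.
rewrite word_exp_cst => <-.
(* For f the identity the left side of [std_stein] is the mean of W^2 + (p / s) W; the linear term
   has mean 0. *)
rewrite -[LHS]addr0 -(mulr0 (p / s k)) -(word_exp_std k0) -word_expZ -word_expD.
by apply: eq_word_exp => w; ring.
Qed.

Let inv_s_le (e : R) : 0 < e -> \forall k \near \oo, (s k)^-1 <= e.
Proof.
move=> e0; near=> k.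
have k0 : (0 < k)%N by near: k; exact: nbhs_infty_gt.
rewrite invf_ple ?posrE ?s_gt0//.
rewrite -[e^-1]ger0_norm ?invr_ge0 ?(ltW e0)// -sqrtr_sqr ler_sqrt; last first.
  by rewrite mulr_ge0// ltW.
rewrite -ler_pdivrMr//; near: k; exact: nbhs_infty_ger.
Unshelve. all: by end_near. Qed.

(** By the mean value theorem s (f(W + 1/s) - f(W)) is a value of f' within 1/s of W, hence close to
    f'(W). The other error in [std_stein], p W (f(W + 1/s) - f(W)), is at most |W| B / s, whose mean
    is controlled by the second moment. *)
Lemma stein_cvg f f' (B : R) :
  (forall x : R, is_derive x 1 f (f' x)) -> (forall x, `|f' x| <= B) ->
  (forall e : R, 0 < e -> exists2 d : R, 0 < d &
     forall x y : R, `|x - y| <= d -> `|f' x - f' y| <= e) ->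
  word_exp p (fun w : k.-tuple bool => std w * f (std w) - f' (std w))
    @[k --> \oo] --> (0 : R).
Proof.
move=> df fB unif; apply/cvgrPdist_le => e e0.
have [d d0 hd] := unif _ (divr_gt0 e0 (ltr0n _ 2)).
have B0 : 0 <= B by exact: le_trans (fB 0).
near=> k; have k0 : (0 < k)%N by near: k; exact: nbhs_infty_gt.
have s0 := s_gt0 k0; set t := (s k)^-1.
have t0 : 0 < t by rewrite invr_gt0.
have td : t <= d.
  by rewrite /t; near: k; exact: inv_s_le.
have tB : t * B <= e / 2.
  (* B may be 0, so the division is by B + 1. *)
  rewrite (@le_trans _ _ (t * (B + 1)))//.
    by rewrite ler_pM2l// lerDl.
  rewrite -ler_pdivlMr; last by lra.
  by rewrite /t; near: k; apply: inv_s_le; apply: divr_gt0; lra.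
have cf (a b : R) : {within `[a, b], continuous f}.
  apply: derivable_within_continuous => x _.
  exact: (@ex_derive _ _ _ _ _ _ _ (df x)).
have mv (x : R) : exists2 c : R, `|c - x| <= t & f (x + t) - f x = f' c * t.
  have xt : x <= x + t by rewrite lerDl ltW.
  have [c + fc] := MVT_segment xt (fun y _ => df y) (cf _ _).
  rewrite in_itv /= => /andP[xc cx].
  exists c; first by rewrite ger0_norm ?subr_ge0// lerBlDl.
  by rewrite fc addrAC subrr add0r.
have := std_stein f k0; rewrite -/t => E.
rewrite sub0r normrN.
have -> : word_exp p (fun w : k.-tuple bool => std w * f (std w) - f' (std w)) =
  word_exp p (fun w : k.-tuple bool =>
    (s k * (f (std w + t) - f (std w)) - f' (std w)) +
    - p * (std w * (f (std w + t) - f (std w)))).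
  rewrite [RHS]word_expD [X in X + _]word_expB -E -[X in X + _]word_expB -word_expD.
  by apply: eq_word_exp => w; ring.
apply: (le_trans (ler_norm_word_exp p01' _)).
(* The inequality 2 |W| <= 1 + W^2 replaces |W| by a quantity of mean 2, leaving e / 2 + t B <=
   e. *)
apply: (@le_trans _ _ (word_exp p (fun w : k.-tuple bool =>
    e / 2 + t * B / 2 * (1 + std w ^+ 2)))); last first.
  rewrite word_expD word_exp_cst word_expZ word_expD word_exp_cst.
  by rewrite word_exp_std2//; lra.
apply: ler_word_exp => // w; set W := std w.
have [c cW ->] := mv W.
apply: (le_trans (ler_normD _ _)); apply: lerD.
  rewrite mulrCA mulfV ?gt_eqF// mulr1.
  by apply: hd; exact: le_trans td.
rewrite normrM normrN normrM [`|f' c * t|]normrM (gtr0_norm t0).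
have p1 : `|p| <= 1 by rewrite ger0_norm; move: p01; lra.
have W2 : 2 * `|W| <= 1 + W ^+ 2.
  by rewrite -(real_normK (num_real W)); have := sqr_ge0 (`|W| - 1); lra.
apply: (@le_trans _ _ (1 * (`|W| * (B * t)))); last first.
  have := ler_wpM2l (mulr_ge0 (ltW t0) B0) W2; lra.
apply: ler_pM; rewrite ?mulr_ge0 ?(ltW t0)//; apply: ler_wpM2l => //.
by apply: ler_wpM2r => //; exact: ltW.
Unshelve. all: by end_near. Qed.

End standardized.

(** * Continuous functions of compact support *)

Section compact_support.
Context {R : realType}.
Variables (g : R -> R) (r : R).
Hypotheses (cg : continuous g) (g0 : forall x : R, r <= `|x| -> g x = 0).

Lemma compact_support_bounded : exists B : R, forall x, `|g x| <= B.
Proof.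
have [r0|r0] := leP r 0.
  by exists 0 => x; rewrite g0 ?normr0// (le_trans r0).
have [c _ hc] : exists2 c, c \in `[- r, r] &
    forall t, t \in `[- r, r] -> `|g t| <= `|g c|.
  apply: (EVT_max (f := fun x => `|g x|)); first by lra.
  apply: continuous_subspaceT => x; apply: cvg_norm; exact: cg.
exists `|g c| => x; have [xr|xr] := leP r `|x|; first by rewrite g0// normr0.
by apply: hc; rewrite in_itv /= -ler_norml ltW.
Qed.

(** Compactness gives one d for all x in the segment of radius r + 1, with y unrestricted. Taking d
    <= 1 settles the other x: then x and y both lie where g vanishes. *)
Lemma compact_support_unif_continuous (e : R) : 0 < e ->
  exists2 d : R, 0 < d & forall x y : R, `|x - y| <= d -> `|g x - g y| <= e.
Proof.
move=> e0.
pose P (d x : R) := forall y, `|x - y| <= d -> `|g x - g y| <= e.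
have /compact_near_coveringP cov := @segment_compact R (- (r + 1)) (r + 1).
have : \forall d \near 0^'+, `[- (r + 1), r + 1] `<=` P d.
  apply: cov => x _; have /cvgrPdist_le/(_ _ (divr_gt0 e0 (ltr0n _ 2))) := @cg x.
  move=> /nbhs_ballP[eta /= eta0 heta].
  near=> x' d => /= y x'y.
  have x'x : `|x - x'| < eta / 2.
    near: x'; apply/nbhs_ballP; exists (eta / 2) => //=; exact: divr_gt0.
  have d0 : d < eta / 2 by near: d; apply: nbhs_right_lt; exact: divr_gt0.
  have h1 : `|g x - g x'| <= e / 2 by apply: heta; rewrite /ball /=; lra.
  have h2 : `|g x - g y| <= e / 2.
    apply: heta; rewrite /ball /=.
    by have := ler_distD x' x y; lra.
  by have := ler_distD (g x) (g x') (g y); rewrite (distrC (g x') (g x)); lra.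
move=> h; have [d [d0 d1 hd]] :
    exists d, [/\ 0 < d, d <= 1 & `[- (r + 1), r + 1] `<=` P d].
  near (0 : R)^'+ => d; exists d; split => //.
  - by near: d; exact: nbhs_right_le.
  - by near: d.
exists d => // x y xy; have [xr|xr] := leP `|x| (r + 1).
  by apply: hd => //; rewrite /= in_itv /= -ler_norml.
have yr : r <= `|y| by have := ler_distD y x 0; rewrite !subr0; lra.
by rewrite !g0 ?subrr ?normr0 ?(ltW e0)//; lra.
Unshelve. all: by end_near. Qed.

End compact_support.

(** * Stein's equation for the Gaussian law *)

Section gauss_mean.
Context {R : realType}.
Implicit Types (h : R -> R) (B : R).
Local Notation leb := (@lebesgue_measure R).
Local Notation gauss := (@normal_pdf R 0 1).

Definition gauss_mean h : R := \int[leb]_x (h x * gauss x).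

Lemma gauss_integrable h B : measurable_fun [set: R] h -> (forall x : R, `|h x| <= B) ->
  leb.-integrable [set: R] (EFin \o (fun x => h x * gauss x)).
Proof.
move=> mh hB.
have iB : leb.-integrable [set: R] (fun x => B%:E * (gauss x)%:E)%E.
  by apply: integrableZl => //; exact: integrable_normal_pdf.
apply: le_integrable iB => //.
- apply/measurable_EFinP/measurable_funM => //; exact: measurable_normal_pdf.
- move=> x _; rewrite -EFinM !abse_EFin lee_fin !normrM ler_wpM2r//.
  exact: le_trans (hB x) (ler_norm _).
Qed.

Lemma gauss_mean_cst B : gauss_mean (fun=> B) = B.
Proof.
rewrite /gauss_mean RintegralZl//; last exact: integrable_normal_pdf.
by rewrite /Rintegral integral_normal_pdf mulr1.
Qed.

Lemma le_gauss_mean h1 h2 B1 B2 :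
  measurable_fun [set: R] h1 -> (forall x : R, `|h1 x| <= B1) ->
  measurable_fun [set: R] h2 -> (forall x : R, `|h2 x| <= B2) ->
  (forall x : R, h1 x <= h2 x) -> gauss_mean h1 <= gauss_mean h2.
Proof.
move=> m1 b1 m2 b2 h12; apply: le_Rintegral => //.
- exact: gauss_integrable b1.
- exact: gauss_integrable b2.
- by move=> x _; rewrite ler_wpM2r// normal_pdf_ge0.
Qed.

Lemma gauss_meanB h1 h2 B1 B2 :
  measurable_fun [set: R] h1 -> (forall x : R, `|h1 x| <= B1) ->
  measurable_fun [set: R] h2 -> (forall x : R, `|h2 x| <= B2) ->
  gauss_mean (fun x => h1 x - h2 x) = gauss_mean h1 - gauss_mean h2.
Proof.
move=> m1 b1 m2 b2; rewrite /gauss_mean -RintegralB//.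
- by apply: eq_Rintegral => x _; rewrite mulrBl.
- exact: gauss_integrable b1.
- exact: gauss_integrable b2.
Qed.

Lemma gauss_meanZ h B c :
  measurable_fun [set: R] h -> (forall x : R, `|h x| <= B) ->
  gauss_mean (fun x => c * h x) = c * gauss_mean h.
Proof.
move=> m b; rewrite /gauss_mean -RintegralZl//; last exact: gauss_integrable b.
by apply: eq_Rintegral => x _; rewrite mulrA.
Qed.

(** The linear equation f' = eta + x f is solved with the integrating factor u = 1 / [gauss], which
    satisfies u' = x u: f = F u, with F the primitive of eta times [gauss] from -oo. Left of the
    support F is 0; right of it F is the full integral, which is 0 because eta has Gaussian mean
    0. *)
Lemma gauss_stein (eta : R -> R) (r : R) : continuous eta ->
  (forall x : R, r <= `|x| -> eta x = 0) -> gauss_mean eta = 0 ->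
  exists2 f : R -> R, (forall x : R, is_derive x 1 f (eta x + x * f x)) &
    (forall x : R, r <= `|x| -> f x = 0).
Proof.
move=> ceta eta0 meta.
have [B hB] := compact_support_bounded ceta eta0.
have meas : measurable_fun [set: R] eta by exact: continuous_measurable_fun.
pose g x := eta x * gauss x.
have cg : continuous g.
  by move=> x; apply: cvgM; [exact: ceta|exact: continuous_normal_pdf].
have ig : leb.-integrable [set: R] (EFin \o g) by exact: gauss_integrable hB.
pose F x := \int[leb]_(t in `]-oo, x]) g t.
have dF (x : R) : is_derive x 1 F (g x).
  have x1 : x < x + 1 by rewrite ltrDl.
  have iu : leb.-integrable `]-oo, (x + 1)] (EFin \o g).
    by apply: integrableS ig => //; exact: measurable_itv.
  have [d1 d2] := continuous_FTC1 x1 iu (ltNyr x) (@cg x).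
  by apply: DeriveDef => //; rewrite -derive1E d2.
have c0 : 0 < normal_peak 1 :> R by exact: normal_peak_gt0 (oner_neq0 _).
pose u x : R := expR (x ^+ 2 / 2) / normal_peak 1.
have du (x : R) : is_derive x 1 u (x * u x).
  rewrite /u; apply: is_derive_eq; rewrite /GRing.scale /=; field; lra.
have gu (x : R) : gauss x * u x = 1.
  rewrite /u normal_pdfE ?oner_neq0//.
  have -> : normal_fun 0 1 x = (expR (x ^+ 2 / 2))^-1.
    by rewrite -expRN /normal_fun subr0 expr1n mulNr.
  by have := expR_gt0 (x ^+ 2 / 2); move=> e0; field; lra.
exists (fun x => F x * u x) => x.
  have h := is_deriveM (dF x) (du x).
  apply: (is_derive_eq h); rewrite /GRing.scale /= /g.
  by rewrite -[eta x]mulr1 -[in RHS](gu x); ring.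
move=> rx; suff -> : F x = 0 by rewrite mul0r.
have [x0|x0] := leP x 0.
  rewrite /F (@eq_Rintegral _ _ _ leb _ (fun=> 0)) ?Rintegral_cst ?mul0r//.
  move=> y; rewrite inE /= in_itv /= => yx; rewrite /g eta0 ?mul0r//.
  by move: rx; rewrite !ler0_norm//; lra.
rewrite -[RHS]meta /gauss_mean /F Rintegral_mkcond; apply: eq_Rintegral => y _.
rewrite patchE; case: ifPn => //; rewrite notin_setE /= in_itv /= => /negP.
rewrite -ltNge => xy; rewrite eta0 ?mul0r//.
by move: rx; rewrite !gtr0_norm//; lra.
Qed.

(* [1 - outer r] is a cutoff to compact support; the bound by (x / r)^2 controls
   its defect under the standardized binomial laws uniformly in k. *)
Definition outer (r x : R) : R := Num.min 1 (x ^+ 2 / r ^+ 2).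

Lemma outer_ge0 r x : 0 <= outer r x.
Proof. by rewrite le_min ler01 divr_ge0 ?sqr_ge0. Qed.

Lemma outer_le1 r x : outer r x <= 1.
Proof. by rewrite ge_min lexx. Qed.

Lemma outer_le r x : outer r x <= x ^+ 2 / r ^+ 2.
Proof. by rewrite ge_min lexx orbT. Qed.

Lemma outer_out r x : 0 < r -> r <= `|x| -> outer r x = 1.
Proof.
move=> r0 rx; apply/min_idPl; rewrite ler_pdivlMr ?exprn_gt0// mul1r.
by rewrite -(real_normK (num_real x)) lerXn2r// nnegrE ltW.
Qed.

Lemma continuous_outer r : continuous (outer r).
Proof.
move=> x; apply: (@continuous_min R R (fun=> 1) (fun x => x ^+ 2 / r ^+ 2)).
  exact: cst_continuous.
by apply: cvgM; [exact: exprn_continuous|exact: cvg_cst].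
Qed.

Lemma norm_outer r x : `|outer r x| <= 1.
Proof. by rewrite ger0_norm ?outer_ge0// outer_le1. Qed.

(** One radius controls the cutoff defect under both laws: r^-2 bounds it for the binomial laws, and
    dominated convergence along integer radii makes it small for the Gaussian law. *)
Lemma gauss_mean_outer (e : R) : 0 < e ->
  exists r : R, [/\ 0 < r, r ^- 2 <= e & gauss_mean (outer r) <= e].
Proof.
move=> e0.
have mo (r : R) : measurable_fun [set: R] (outer r).
  by apply: continuous_measurable_fun; exact: continuous_outer.
have sq (a d : R) : 0 <= a -> 0 < d -> \forall n \near \oo, a / n%:R ^+ 2 <= d.
  move=> a0 d0; near=> n; have n1 : 1 <= n%:R :> R by near: n; exact: nbhs_infty_ger.
  have n0 : 0 < n%:R :> R by lra.
  rewrite ler_pdivrMr ?exprn_gt0//.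
  have : a / d <= n%:R by near: n; exact: nbhs_infty_ger.
  rewrite ler_pdivrMr// mulrC => /le_trans; apply; rewrite ler_pM2l//.
  by rewrite expr2 ler_peMr//; lra.
have oc x : outer n%:R x @[n --> \oo] --> (0 : R).
  apply/cvgr0Pnorm_le => d d0; have := sq _ _ (sqr_ge0 x) d0.
  by apply: filterS => n; apply: le_trans; rewrite ger0_norm ?outer_ge0 ?outer_le.
have : gauss_mean (outer n%:R) @[n --> \oo] --> (0 : R).
  apply: fine_cvg.
  have -> : 0%:E = (\int[leb]_x 0%:E)%E by rewrite integral0.
  apply: (@dominated_cvg _ _ _ leb _ _ _ _ (fun x => (gauss x)%:E)) => //.
  - move=> n; apply/measurable_EFinP; apply: measurable_funM.
      exact: mo.
    exact: measurable_normal_pdf.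
  - move=> x _; apply: cvg_EFin; first exact: nearW.
    rewrite /= -[X in _ --> X](mul0r (gauss x)); apply: cvgMl; exact: oc.
  - exact: integrable_normal_pdf.
  - move=> n x _; rewrite lee_fin normrM (ger0_norm (normal_pdf_ge0 _ _ _)).
    by rewrite ler_piMl ?normal_pdf_ge0// norm_outer.
move=> /cvgr0_norm_le/(_ _ e0) h; near \oo => n.
have n0 : (0 < n)%N by near: n; exact: nbhs_infty_gt.
exists n%:R; split.
- by rewrite ltr0n.
- by rewrite -[leLHS]mul1r; near: n; exact: sq.
- apply: le_trans (ler_norm _) _; near: n; exact: h.
Unshelve. all: by end_near. Qed.

End gauss_mean.

(** * Convergence of means of continuous test functions *)

Section clt.
Context {R : realType} (p : R).
Hypothesis p01 : 0 < p < 1.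
Local Notation std := (std p).

Let p01' : 0 <= p <= 1. Proof. by move: p01 => /andP[/ltW -> /ltW ->]. Qed.

(** With f the solution of Stein's equation, eta(W) = f'(W) - W f(W), and f' inherits continuity and
    compact support, so [stein_cvg] applies. *)
Lemma std_cvg_compact (eta : R -> R) (r : R) : continuous eta ->
  (forall x : R, r <= `|x| -> eta x = 0) -> gauss_mean eta = 0 ->
  word_exp p (fun w : k.-tuple bool => eta (std w)) @[k --> \oo] --> (0 : R).
Proof.
move=> ceta eta0 meta; have [f df f0] := gauss_stein ceta eta0 meta.
pose f' x := eta x + x * f x.
have cf' : continuous f'.
  move=> x; apply: cvgD; first exact: ceta.
  apply: cvgM; first exact: cvg_id.
  apply: differentiable_continuous; apply/derivable1_diffP.
  exact: (@ex_derive _ _ _ _ _ _ _ (df x)).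
have f'0 (x : R) : r <= `|x| -> f' x = 0.
  by move=> rx; rewrite /f' eta0// f0// mulr0 addr0.
have [B hB] := compact_support_bounded cf' f'0.
have := stein_cvg p01 df hB (compact_support_unif_continuous cf' f'0).
move=> /(@cvgN _ R); rewrite oppr0; apply: cvg_trans; apply: near_eq_cvg.
apply: nearW => k; rewrite fctE -mulN1r -word_expZ.
by apply: eq_word_exp => w; ring.
Qed.

Lemma word_exp_outer (r : R) k : (0 < k)%N ->
  word_exp p (fun w : k.-tuple bool => outer r (std w)) <= r ^- 2.
Proof.
move=> k0; rewrite -[leRHS]mulr1 -(word_exp_std2 p01 k0) -word_expZ.
by apply: ler_word_exp => // w; rewrite mulrC outer_le.
Qed.

(** Reduction to [std_cvg_compact]: h is cut off by c, and a multiple of c is subtracted to center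
    it. The total error is at most e / 4 plus four terms of size at most e / 8. *)
Lemma std_cvg (h : R -> R) : continuous h -> (forall x : R, 0 <= h x <= 1) ->
  word_exp p (fun w : k.-tuple bool => h (std w)) @[k --> \oo] --> gauss_mean h.
Proof.
move=> ch h01; apply/cvgrPdist_le => e e0.
have e8 : 0 < e / 8 by lra.
have [r [r0 r2 tau]] := gauss_mean_outer e8.
pose c x := 1 - outer r x.
have h0 x : 0 <= h x by have /andP[] := h01 x.
have h1 x : h x <= 1 by have /andP[] := h01 x.
have c0 x : 0 <= c x by rewrite subr_ge0 outer_le1.
have c1 x : c x <= 1 by rewrite lerBlDr lerDl outer_ge0.
have cc : continuous c.
  by move=> x; apply: cvgB; [exact: cvg_cst|exact: continuous_outer].
have chc : continuous (fun x => h x * c x).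
  by move=> x; apply: cvgM; [exact: ch|exact: cc].
have hc0 x : 0 <= h x * c x by exact: mulr_ge0.
have hc1 x : h x * c x <= 1 by rewrite mulr_ile1.
have nb (f : R -> R) : (forall x, 0 <= f x) -> (forall x, f x <= 1) ->
    forall x, `|f x| <= 1 by move=> f0 f1 x; rewrite ger0_norm.
have mh := continuous_measurable_fun ch.
have mc := continuous_measurable_fun cc.
have mhc := continuous_measurable_fun chc.
have mo : measurable_fun [set: R] (outer r).
  by apply: continuous_measurable_fun; exact: continuous_outer.
set m0 := gauss_mean c; set m1 := gauss_mean (fun x => h x * c x).
set I := gauss_mean h; set t := gauss_mean (outer r) in tau.
have m0E : m0 = 1 - t.
  rewrite -[1](@gauss_mean_cst R) /m0 /t -(@gauss_meanB _ _ _ 1 1)//.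
  - by move=> x; rewrite normr1.
  - exact: norm_outer.
have t0 : 0 <= t.
  rewrite -(@gauss_mean_cst R 0); apply: (@le_gauss_mean _ _ _ 0 1) => //.
  - by move=> x; rewrite normr0.
  - exact: norm_outer.
  - exact: outer_ge0.
have m1_ge0 : 0 <= m1.
  rewrite -(@gauss_mean_cst R 0); apply: (@le_gauss_mean _ _ _ 0 1) => //.
  - by move=> x; rewrite normr0.
  - exact: nb.
have m1_le1 : m1 <= 1.
  rewrite -(@gauss_mean_cst R 1); apply: (@le_gauss_mean _ _ _ 1 1) => //.
  - exact: nb.
  - by move=> x; rewrite normr1.
have m1I : m1 <= I.
  apply: (@le_gauss_mean _ _ _ 1 1) => //; [exact: nb|exact: nb|].
  by move=> x; rewrite ler_piMr.
have Im1 : I - m1 <= t.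
  rewrite /I /m1 -(@gauss_meanB _ _ _ 1 1)//; [|exact: nb|exact: nb].
  apply: (@le_gauss_mean _ _ _ 1 1) => //.
  - exact: measurable_funB.
  - apply: nb => x; first by rewrite subr_ge0 ler_piMr.
    by rewrite lerBlDr (le_trans (h1 x))// lerDl.
  - exact: norm_outer.
  - by move=> x; rewrite /c mulrBr mulr1 subKr ler_piMl// outer_ge0.
(* The Gaussian mean is m0 m1 - m1 m0 = 0. Both m0 and the binomial mean of c are close to 1, so the
   convergence for eta compares the mean of h c with m1. *)
pose eta x := m0 * (h x * c x) - m1 * c x.
have eta_cvg :
    word_exp p (fun w : k.-tuple bool => eta (std w)) @[k --> \oo] --> (0 : R).
  apply: (@std_cvg_compact _ r).
  - by move=> x; apply: cvgB; apply: cvgM;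
      [exact: cvg_cst|exact: chc|exact: cvg_cst|exact: cc].
  - by move=> x rx; rewrite /eta /c outer_out// subrr !mulr0 subrr.
  - rewrite /eta (@gauss_meanB _ _ _ `|m0| `|m1|).
    + rewrite (@gauss_meanZ _ _ 1)//; last exact: nb.
      by rewrite (@gauss_meanZ _ _ 1)//; [rewrite -/m0 -/m1 mulrC subrr|exact: nb].
    + exact: measurable_funM.
    + by move=> x; rewrite normrM ler_piMr// (nb _ hc0 hc1).
    + exact: measurable_funM.
    + by move=> x; rewrite normrM ler_piMr// (nb _ c0 c1).
have e4 : 0 < e / 4 by lra.
have /cvgr0Pnorm_le/(_ _ e4) eta_le := eta_cvg.
near=> k.
have k0 : (0 < k)%N by near: k; exact: nbhs_infty_gt.
have Ek : `|word_exp p (fun w : k.-tuple bool => eta (std w))| <= e / 4.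
  by near: k; exact: eta_le.
move: Ek; rewrite /eta word_expB !word_expZ.
set A1 := word_exp p (fun w : k.-tuple bool => h (std w) * c (std w)).
set C := word_exp p (fun w : k.-tuple bool => c (std w)).
set A := word_exp p (fun w : k.-tuple bool => h (std w)) => Ek.
set T := word_exp p (fun w : k.-tuple bool => outer r (std w)).
have Te : T <= e / 8 := le_trans (word_exp_outer r k0) r2.
have CE : C = 1 - T.
  by rewrite -[1](word_exp_cst p k) -word_expB.
have T0 : 0 <= T by apply: word_exp_ge0 => // w; exact: outer_ge0.
have A1_ge0 : 0 <= A1 by apply: word_exp_ge0.
have A1_le1 : A1 <= 1 by rewrite -[leRHS](word_exp_cst p k); apply: ler_word_exp.
have A1A : A1 <= A by apply: ler_word_exp => // w; rewrite ler_piMr.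
have AA1 : A - A1 <= T.
  rewrite -word_expB; apply: ler_word_exp => // w.
  by rewrite /c mulrBr mulr1 subKr ler_piMl// outer_ge0.
have : 0 <= t * A1 <= t by rewrite mulr_ge0//= ler_piMr.
have : 0 <= m1 * T <= T by rewrite mulr_ge0//= ler_piMl.
move: Ek; rewrite m0E CE !ler_norml; lra.
Unshelve. all: by end_near. Qed.

End clt.

(** * The de Moivre-Laplace theorem *)

Section Phi.
Context {R : realType}.
Implicit Types (a b t x : R).
Local Notation leb := (@lebesgue_measure R).
Local Notation gauss := (@normal_pdf R 0 1).

Lemma PhiE t : Phi t = \int[leb]_(x in `]-oo, t]) gauss x.
Proof. by rewrite -[LHS]/(fine (Phi t)%:E) Phi_normal_prob. Qed.

Lemma measurable_le_indic t : measurable_fun [set: R] (fun x => (x <= t)%R%:R : R).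
Proof.
have -> : (fun x => (x <= t)%R%:R : R) = \1_`]-oo, t].
  by apply/funext => x; rewrite indicE mem_setE in_itv.
exact: measurable_indic.
Qed.

Lemma gauss_mean_le t : gauss_mean (fun x => (x <= t)%R%:R) = Phi t.
Proof.
rewrite PhiE Rintegral_mkcond; apply: eq_Rintegral => x _.
by rewrite patchE mem_setE in_itv /=; case: (x <= t); rewrite ?mul1r ?mul0r.
Qed.

Lemma Phi_lipschitz a b : a <= b -> Phi b - Phi a <= (b - a) * normal_peak 1.
Proof.
move=> ab; have lab : leb `]a, b] = (b - a)%:E.
  rewrite lebesgue_measure_itv /= lte_fin; case: ltgtP ab => // -> _.
  by rewrite subrr.
rewrite !PhiE Rintegral_itvB; first last.
- by rewrite bnd_simp.
- by rewrite bnd_simp.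
- by apply: integrableS (integrable_normal_pdf 0 1).
apply: (@le_trans _ _ (\int[leb]_(x in `]a, b]) normal_peak 1)).
  apply: le_Rintegral => //.
  - by apply: integrableS (integrable_normal_pdf 0 1).
  - apply: measurable_bounded_integrable => //.
    + by have := ltry (b - a); rewrite -lab.
    + exact: bounded_cst.
  - by move=> x _; rewrite normal_pdf_ub// oner_neq0.
by rewrite Rintegral_cst// [X in fine X](_ : _ = (b - a)%:E)//= mulrC.
Qed.

(** For a < b, a continuous piecewise linear function squeezed between the indicators of x <= a and
    x <= b. *)
Definition ramp a b x : R := Num.max 0 (Num.min 1 ((b - x) / (b - a))).

Lemma continuous_ramp a b : continuous (ramp a b).
Proof.
move=> x; apply: (@continuous_max R R (fun=> 0)
  (fun x => Num.min 1 ((b - x) / (b - a)))); first exact: cst_continuous.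
apply: (@continuous_min R R (fun=> 1) (fun x => (b - x) / (b - a))).
  exact: cst_continuous.
apply: cvgM; last exact: cvg_cst.
by apply: cvgB; [exact: cvg_cst|exact: cvg_id].
Qed.

Lemma ramp01 a b x : 0 <= ramp a b x <= 1.
Proof. by rewrite le_max lexx /= ge_max ler01 ge_min lexx. Qed.

Lemma le_ramp a b x : a < b -> (x <= a)%R%:R <= ramp a b x.
Proof.
move=> ab; rewrite /ramp; case: (leP x a) => [xa|_] /=; last by rewrite le_max lexx.
by rewrite le_max le_min lexx /= ler_pdivlMr ?subr_gt0// mul1r lerD2l lerN2 xa orbT.
Qed.

Lemma ramp_le a b x : a < b -> ramp a b x <= (x <= b)%R%:R.
Proof.
move=> ab; case: (leP x b) => [xb|bx] /=; first by have /andP[] := ramp01 a b x.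
rewrite /ramp ge_max lexx /= ge_min pmulr_lle0 ?invr_gt0 ?subr_gt0// subr_le0.
by rewrite (ltW bx) orbT.
Qed.

Let norm_ramp a b x : `|ramp a b x| <= 1.
Proof. by have /andP[r0 r1] := ramp01 a b x; rewrite ger0_norm. Qed.

Let norm_nat (c : bool) : `|c%:R : R| <= 1.
Proof. by rewrite normr_nat lern1 leq_b1. Qed.

Lemma gauss_mean_ramp a b : a < b -> Phi a <= gauss_mean (ramp a b) <= Phi b.
Proof.
move=> ab; have mr := continuous_measurable_fun (@continuous_ramp a b).
rewrite -!gauss_mean_le; apply/andP; split.
- apply: (@le_gauss_mean _ _ _ 1 1) => //; first exact: measurable_le_indic.
  by move=> x; exact: le_ramp.
- apply: (@le_gauss_mean _ _ _ 1 1) => //; first exact: measurable_le_indic.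
  by move=> x; exact: ramp_le.
Qed.

End Phi.

Section moivre_laplace.
Context {R : realType} (p : R).
Hypothesis p01 : 0 < p < 1.

Let p01' : 0 <= p <= 1. Proof. by move: p01 => /andP[/ltW -> /ltW ->]. Qed.

Let cdf k (t : R) : R := word_prob p [pred w : k.-tuple bool | std p w <= t].

(** The distribution function at t_k is squeezed between the means of two ramps, on [t - 2d, t - d]
    and [t + d, t + 2d]. The gap d around t absorbs the moving threshold. *)
Theorem moivre_laplace (t_ : R^nat) (t : R) : t_ k @[k --> \oo] --> t ->
  cdf k (t_ k) @[k --> \oo] --> Phi t.
Proof.
move=> t_t; apply/cvgrPdist_le => e e0.
have c0 : 0 < normal_peak 1 :> R by exact: normal_peak_gt0 (oner_neq0 _).
(* By [Phi_lipschitz], [Phi] varies by at most e / 2 over a length 2d; the other e / 2 is for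
   [std_cvg]. *)
pose d : R := e / (4 * normal_peak 1).
have d0 : 0 < d by apply: divr_gt0 => //; lra.
have dE : (2 * d) * normal_peak 1 = e / 2 by rewrite /d; field; lra.
have e2 : 0 < e / 2 by lra.
have U1 : t + d < t + 2 * d by lra.
have L1 : t - 2 * d < t - d by lra.
have /cvgrPdist_le/(_ _ e2) U := std_cvg p01
  (@continuous_ramp _ (t + d) (t + 2 * d)) (@ramp01 _ _ _).
have /cvgrPdist_le/(_ _ e2) L := std_cvg p01
  (@continuous_ramp _ (t - 2 * d) (t - d)) (@ramp01 _ _ _).
have /andP[_ U2] := gauss_mean_ramp U1.
have /andP[L2 _] := gauss_mean_ramp L1.
have U3 : Phi (t + 2 * d) - Phi t <= e / 2.
  have /Phi_lipschitz : t <= t + 2 * d by lra.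
  by rewrite [t + 2 * d - t]addrAC subrr add0r dE.
have L3 : Phi t - Phi (t - 2 * d) <= e / 2.
  have /Phi_lipschitz : t - 2 * d <= t by lra.
  by rewrite subKr dE.
move/cvgrPdist_le/(_ _ d0) : t_t => t_t.
near=> k.
have Uk : `|gauss_mean (ramp (t + d) (t + 2 * d)) -
    word_exp p (fun w : k.-tuple bool => ramp (t + d) (t + 2 * d) (std p w))| <= e / 2.
  by near: k; exact: U.
have Lk : `|gauss_mean (ramp (t - 2 * d) (t - d)) -
    word_exp p (fun w : k.-tuple bool => ramp (t - 2 * d) (t - d) (std p w))| <= e / 2.
  by near: k; exact: L.
have : `|t - t_ k| <= d by near: k; exact: t_t.
rewrite ler_norml => /andP[tk1 tk2].
have PU : cdf k (t_ k) <=
    word_exp p (fun w : k.-tuple bool => ramp (t + d) (t + 2 * d) (std p w)).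
  rewrite /cdf word_probE; apply: ler_word_exp => // w /=.
  apply: le_trans (le_ramp _ U1); rewrite ler_nat.
  by case: leP => //= h1; case: leP => //= h2; lra.
have PL : word_exp p (fun w : k.-tuple bool => ramp (t - 2 * d) (t - d) (std p w)) <=
    cdf k (t_ k).
  rewrite /cdf word_probE; apply: ler_word_exp => // w /=.
  apply: le_trans (ramp_le _ L1) _; rewrite ler_nat.
  by case: leP => //= h1; case: leP => //= h2; lra.
move: Uk Lk; rewrite !ler_norml; lra.
Unshelve. all: by end_near. Qed.

Lemma chebyshev_std k (A : R) : (0 < k)%N -> 0 < A ->
  word_prob p [pred w : k.-tuple bool | A <= `|std p w|] <= A ^- 2.
Proof.
move=> k0 A0; rewrite -[leRHS]mulr1 -(word_exp_std2 p01 k0) -word_expZ word_probE.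
apply: ler_word_exp => // w /=; case: (leP A `|std p w|) => /= h; last first.
  by rewrite mulr_ge0 ?sqr_ge0// invr_ge0 exprn_ge0// ltW.
rewrite mulrC ler_pdivlMr ?exprn_gt0// mul1r -(real_normK (num_real (std p w))).
by rewrite lerXn2r// nnegrE ltW.
Qed.

Let sq_inv_le (e : R) : 0 < e -> exists2 A : R, 0 < A & A ^- 2 <= e.
Proof.
move=> e0; exists (1 + e^-1); first by rewrite addr_gt0// invr_gt0.
have i0 : 0 < e^-1 by rewrite invr_gt0.
rewrite invf_ple ?posrE// ?exprn_gt0 ?addr_gt0// expr2; nra.
Qed.

(** For thresholds tending to infinity, Chebyshev's inequality at a fixed large level A is
    enough. *)
Lemma std_cdf_cvg1 (t_ : R^nat) : t_ k @[k --> \oo] --> +oo ->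
  cdf k (t_ k) @[k --> \oo] --> (1 : R).
Proof.
move=> t_y; apply/cvgrPdist_le => e e0; have [A A0 Ae] := sq_inv_le e0.
near=> k; have k0 : (0 < k)%N by near: k; exact: nbhs_infty_gt.
have tA : A <= t_ k by near: k; move/cvgryPge : t_y; exact.
rewrite ger0_norm ?subr_ge0 ?word_prob_le1// -word_probC//.
apply: le_trans Ae; apply: le_trans (chebyshev_std k0 A0).
apply: le_word_prob => // w /=; rewrite -ltNge => h.
by rewrite (le_trans tA)// (le_trans (ltW h))// ler_norm.
Unshelve. all: by end_near. Qed.

Lemma std_cdf_cvg0 (t_ : R^nat) : t_ k @[k --> \oo] --> -oo ->
  cdf k (t_ k) @[k --> \oo] --> (0 : R).
Proof.
move=> t_y; apply/cvgrPdist_le => e e0; have [A A0 Ae] := sq_inv_le e0.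
near=> k; have k0 : (0 < k)%N by near: k; exact: nbhs_infty_gt.
have tA : t_ k <= - A by near: k; move/cvgrNyPle : t_y; exact.
rewrite sub0r normrN ger0_norm ?word_prob_ge0//.
apply: le_trans Ae; apply: le_trans (chebyshev_std k0 A0).
apply: le_word_prob => // w /= h.
by rewrite ler_normr lerNr (le_trans h) ?orbT.
Unshelve. all: by end_near. Qed.

End moivre_laplace.

(** * Words below a threshold of the expected count *)

Section sqrt_limits.
Context {R : realType}.

Lemma cvg_sqrt_pinfty (u : R^nat) : u k @[k --> \oo] --> +oo ->
  Num.sqrt (u k) @[k --> \oo] --> +oo.
Proof.
move=> /cvgryPge uy; apply/cvgryPge => A; apply: filterS (uy (A ^+ 2)) => k Ak.
by rewrite (le_trans (ler_norm A))// -sqrtr_sqr ler_wsqrtr.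
Qed.

Lemma cvg_natr_pinfty : (k%:R : R) @[k --> \oo] --> +oo.
Proof. by apply/cvgryPge => A; exact: nbhs_infty_ger. Qed.

Lemma cvg_inv_sqrt : (Num.sqrt k%:R)^-1 @[k --> \oo] --> (0 : R).
Proof.
apply/gtr0_cvgV0; last exact: cvg_sqrt_pinfty cvg_natr_pinfty.
by exists 1%N => // k /= k0; rewrite sqrtr_gt0 ltr0n.
Qed.

(** With y = k^(1/4) the quotient is 4 ln y / y^2, which is at most 4 / y. *)
Lemma cvg_ln_div_sqrt : ln k%:R / Num.sqrt k%:R @[k --> \oo] --> (0 : R).
Proof.
apply: (@squeeze_cvgr _ _ _ _ (fun=> 0) (fun k => 4 * (Num.sqrt (Num.sqrt k%:R))^-1)).
- near=> k; have k0 : (0 < k)%N by near: k; exact: nbhs_infty_gt.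
  set y := Num.sqrt (Num.sqrt k%:R).
  have y0 : 0 < y by rewrite !sqrtr_gt0 ltr0n.
  have y2 : Num.sqrt k%:R = y ^+ 2 by rewrite sqr_sqrtr// sqrtr_ge0.
  have -> : k%:R = y ^+ 4 :> R by rewrite (exprM y 2 2) -y2 sqr_sqrtr.
  have -> : Num.sqrt (y ^+ 4) = y ^+ 2.
    by rewrite (exprM y 2 2) sqrtr_sqr ger0_norm// exprn_ge0// ltW.
  have le1 (z : R) : 1 <= z -> 1 <= Num.sqrt z.
    by move=> z1; rewrite -[leLHS](@sqrtr1 R) ler_wsqrtr.
  have y1 : 1 <= y by apply/le1/le1; rewrite ler1n.
  rewrite lnXn//; apply/andP; split.
    by rewrite divr_ge0 ?exprn_ge0 ?mulrn_wge0 ?ln_ge0// ltW.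
  rewrite ler_pdivrMr ?exprn_gt0// -[ln y *+ 4]mulr_natl.
  have -> : 4 * y^-1 * y ^+ 2 = 4 * y by field; rewrite gt_eqF.
  by rewrite ler_pM2l// ltW// ln_sublinear.
- exact: cvg_cst.
- rewrite -[X in _ --> X](mulr0 4); apply: cvgMr.
  apply/gtr0_cvgV0; last exact/cvg_sqrt_pinfty/cvg_sqrt_pinfty/cvg_natr_pinfty.
  by exists 1%N => // k /= k0; rewrite !sqrtr_gt0 ltr0n.
Unshelve. all: by end_near. Qed.

End sqrt_limits.

Section threshold.
Context {R : realType} (p : R) (hp : 2^-1 < p < 1).
Variable N : nat -> nat.
Hypothesis N0 : forall k : nat, (0 < k)%N -> (0 < N k)%N.

Let p0 : 0 < p. Proof. by move: hp; lra. Qed.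
Let q0 : 0 < 1 - p. Proof. by move: hp; lra. Qed.
Let p01 : 0 < p < 1. Proof. by move: hp; lra. Qed.
Let pq0 : 0 < p * (1 - p). Proof. exact: mulr_gt0. Qed.

Let rho := ln (p / (1 - p)).
Let sigma := Num.sqrt (p * (1 - p)).
(** The entropy in nats: 2^(k H(p)) = exp(k [ent]). *)
Let ent := - (p * ln p + (1 - p) * ln (1 - p)).

(** Since p > 1/2, ones are the likelier letters, so the rare words are those with a small
    standardized number of ones. *)
Let rho0 : 0 < rho.
Proof. by rewrite ln_gt0// ltr_pdivlMr// mul1r; move: hp; lra. Qed.

Let sigma0 : 0 < sigma. Proof. by rewrite sqrtr_gt0. Qed.

Lemma word_pmf_expR k (w : k.-tuple bool) :
  word_pmf p w = expR ((ones w)%:R * ln p + (k%:R - (ones w)%:R) * ln (1 - p)).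
Proof.
rewrite /word_pmf /ones; elim: k w => [|k IH] w.
  by rewrite big_ord0 tuple0 /= !mul0r subrr mul0r addr0 expR0.
case/tupleP: w => b w; rewrite big_ord_recl tnth0.
under eq_bigr do rewrite tnthS.
rewrite IH /= natrD -natr1; case: b => /=.
- rewrite -[X in X * _](lnK p0) -expRD; congr expR; ring.
- rewrite -[X in X * _](lnK q0) -expRD; congr expR; ring.
Qed.

Lemma word_pmf_std k (w : k.-tuple bool) : (0 < k)%N ->
  word_pmf p w = expR (- (k%:R * ent) + rho * sigma * Num.sqrt k%:R * std p w).
Proof.
move=> k0; rewrite word_pmf_expR; congr expR.
have sE : Num.sqrt (k%:R * (p * (1 - p))) = Num.sqrt k%:R * sigma by rewrite sqrtrM.
have s0 : 0 < Num.sqrt k%:R :> R by rewrite sqrtr_gt0 ltr0n.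
have -> : (ones w)%:R = k%:R * p + Num.sqrt k%:R * sigma * std p w.
  by rewrite /std sE; field; rewrite !gt_eqF.
by rewrite /rho ln_div ?posrE// /ent; ring.
Qed.

Lemma scaleE (a : R) k : 0 < a ->
  scale p a k = expR (k%:R * ent + Num.sqrt k%:R * ln a).
Proof.
move=> a0; rewrite /scale /powR gt_eqF// [in X in _ * X]gt_eqF// -expRD.
congr (expR (_ + _)).
have l2 : 0 < ln 2 :> R by rewrite ln_gt0// ltr1n.
by rewrite /binary_entropy /log_base /ent; field; rewrite gt_eqF.
Qed.

(* N_k = 2^(k H(p)) exp(beta_k sqrt k). *)
Let beta k : R := (ln (N k)%:R - k%:R * ent) / Num.sqrt k%:R.

Lemma ratio_scale (a : R) k : 0 < a -> (0 < k)%N ->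
  (N k)%:R / scale p a k = expR (Num.sqrt k%:R * (beta k - ln a)).
Proof.
move=> a0 k0; rewrite scaleE// -[X in X / _]lnK ?posrE ?ltr0n ?N0// -expRN -expRD.
have s0 : 0 < Num.sqrt k%:R :> R by rewrite sqrtr_gt0 ltr0n.
by congr expR; rewrite /beta; field; rewrite gt_eqF.
Qed.

(** Comparing N_k with the scale at a = e^A, a ratio of at most 1 already forces beta_k <= A. *)
Lemma beta_o : (forall a : R, 0 < a -> is_o (fun k => (N k)%:R) (scale p a)) ->
  beta k @[k --> \oo] --> -oo.
Proof.
move=> h; apply/cvgrNyPle => A.
have /cvgr0Pnorm_le/(_ _ ltr01) hA := h _ (expR_gt0 A).
near=> k; have k0 : (0 < k)%N by near: k; exact: nbhs_infty_gt.
have : `|(N k)%:R / scale p (expR A) k| <= 1 by near: k; exact: hA.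
rewrite ratio_scale ?expR_gt0// expRK ger0_norm ?expR_ge0// -[leRHS]expR0 ler_expR.
by rewrite pmulr_rle0 ?subr_le0// sqrtr_gt0 ltr0n.
Unshelve. all: by end_near. Qed.

Lemma beta_omega : (forall a : R, 0 < a -> is_omega (fun k => (N k)%:R) (scale p a)) ->
  beta k @[k --> \oo] --> +oo.
Proof.
move=> h; apply/cvgryPge => A.
have /cvgryPge/(_ 1) hA := h _ (expR_gt0 A).
near=> k; have k0 : (0 < k)%N by near: k; exact: nbhs_infty_gt.
have : 1 <= (N k)%:R / scale p (expR A) k by near: k; exact: hA.
rewrite ratio_scale ?expR_gt0// expRK -[leLHS]expR0 ler_expR.
by rewrite pmulr_rge0 ?subr_ge0// sqrtr_gt0 ltr0n.
Unshelve. all: by end_near. Qed.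

(** The constants C1 and C2 move beta_k by only ln C1 / sqrt k and ln C2 / sqrt k. *)
Lemma beta_Theta (a : R) : 0 < a -> is_Theta (fun k => (N k)%:R) (scale p a) ->
  beta k @[k --> \oo] --> ln a.
Proof.
move=> a0 [C1 [C2 [C10 C20 hC]]].
have lim (C : R) : ln a + ln C * (Num.sqrt k%:R)^-1 @[k --> \oo] --> ln a.
  rewrite -[X in _ --> X]addr0 -[X in _ + X](mulr0 (ln C)).
  apply: cvgD; first exact: cvg_cst.
  by apply: cvgM; [exact: cvg_cst|exact: cvg_inv_sqrt].
apply: (@squeeze_cvgr _ _ _ _ (fun k => ln a + ln C1 * (Num.sqrt k%:R)^-1)
  (fun k => ln a + ln C2 * (Num.sqrt k%:R)^-1)) => //.
near=> k; have k0 : (0 < k)%N by near: k; exact: nbhs_infty_gt.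
have s0 : 0 < Num.sqrt k%:R :> R by rewrite sqrtr_gt0 ltr0n.
have : C1 <= (N k)%:R / scale p a k <= C2 by near: k.
rewrite ratio_scale// -{1}(lnK C10) -{1}(lnK C20) !ler_expR => /andP[h1 h2].
apply/andP; split; first by rewrite -lerBrDl ler_pdivrMr// mulrC.
by rewrite -lerBlDl ler_pdivlMr// mulrC.
Unshelve. all: by end_near. Qed.

Variable theta : R^nat.
Hypothesis theta0 : forall k : nat, (0 < k)%N -> 0 < theta k.
Hypothesis ltheta : ln (theta k) / Num.sqrt k%:R @[k --> \oo] --> (0 : R).

(** The value of W at which the expected count exp(sqrt k (beta_k + rho sigma W)) equals theta_k. As
    ln theta_k = o(sqrt k), its limit does not depend on theta, so the thresholds k^-4 and k^6
    become interchangeable. *)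
Let thr k := (ln (theta k) / Num.sqrt k%:R - beta k) / (rho * sigma).

Let rare k := [pred w : k.-tuple bool | (N k)%:R * word_pmf p w <= theta k].

Let rareE k (w : k.-tuple bool) : (0 < k)%N -> rare k w = (std p w <= thr k).
Proof.
move=> k0; have s0 : 0 < Num.sqrt k%:R :> R by rewrite sqrtr_gt0 ltr0n.
rewrite /= word_pmf_std// -[X in X * _]lnK ?posrE ?ltr0n ?N0// -expRD.
rewrite -[X in _ <= X](lnK (theta0 k0)) ler_expR /thr ler_pdivlMr ?mulr_gt0//.
by rewrite -mulrBl ler_pdivlMr// opprB; apply/idP/idP => h; lra.
Qed.

Let rare_cdf k : (0 < k)%N -> word_prob p (rare k) =
  word_prob p [pred w : k.-tuple bool | std p w <= thr k].
Proof. by move=> k0; apply: eq_bigl => w; rewrite rareE. Qed.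

Let near_rare : \forall k \near \oo,
  word_prob p [pred w : k.-tuple bool | std p w <= thr k] = word_prob p (rare k).
Proof. by exists 1%N => // k /= k0; rewrite rare_cdf. Qed.

Lemma rare_o : (forall a : R, 0 < a -> is_o (fun k => (N k)%:R) (scale p a)) ->
  word_prob p (rare k) @[k --> \oo] --> (1 : R).
Proof.
move=> /beta_o bo; apply: (cvg_trans (near_eq_cvg near_rare)).
apply: std_cdf_cvg1 => //.
move/cvgr0Pnorm_le/(_ _ ltr01) : ltheta => lt; move/cvgrNyPle : bo => bo.
apply/cvgryPge => A; near=> k.
have : `|ln (theta k) / Num.sqrt k%:R| <= 1 by near: k.
have : beta k <= - (A * (rho * sigma) + 1) by near: k; exact: bo.
rewrite ler_norml => bA /andP[t1 t2]; rewrite /thr ler_pdivlMr ?mulr_gt0//; lra.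
Unshelve. all: by end_near. Qed.

Lemma rare_omega : (forall a : R, 0 < a -> is_omega (fun k => (N k)%:R) (scale p a)) ->
  word_prob p (rare k) @[k --> \oo] --> (0 : R).
Proof.
move=> /beta_omega bo; apply: (cvg_trans (near_eq_cvg near_rare)).
apply: std_cdf_cvg0 => //.
move/cvgr0Pnorm_le/(_ _ ltr01) : ltheta => lt; move/cvgryPge : bo => bo.
apply/cvgrNyPle => A; near=> k.
have : `|ln (theta k) / Num.sqrt k%:R| <= 1 by near: k.
have : 1 - A * (rho * sigma) <= beta k by near: k; exact: bo.
rewrite ler_norml => bA /andP[t1 t2]; rewrite /thr ler_pdivrMr ?mulr_gt0//; lra.
Unshelve. all: by end_near. Qed.

Lemma rare_Theta (a : R) : 0 < a -> is_Theta (fun k => (N k)%:R) (scale p a) ->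
  word_prob p (rare k) @[k --> \oo] -->
  Phi (- (log_base (p / (1 - p)) a / Num.sqrt (p * (1 - p)))).
Proof.
move=> a0 /(beta_Theta a0) bt; apply: (cvg_trans (near_eq_cvg near_rare)).
apply: moivre_laplace => //.
have -> : - (log_base (p / (1 - p)) a / Num.sqrt (p * (1 - p))) =
    (0 - ln a) / (rho * sigma).
  by rewrite /log_base -/rho -/sigma; field; rewrite !gt_eqF.
by apply: cvgM; [exact: cvgB|exact: cvg_cst].
Qed.

End threshold.

(** * From expected counts to actual counts *)

Section sandwich.
Context {R : realType}.

Lemma cvg_ln_exp_div_sqrt (n : nat) :
  ln (k%:R ^+ n) / Num.sqrt k%:R @[k --> \oo] --> (0 : R).
Proof.
rewrite -[X in _ --> X](mulr0 n%:R).
have : n%:R * (ln k%:R / Num.sqrt k%:R) @[k --> \oo] --> (n%:R * 0 : R).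
  by apply: cvgM; [exact: cvg_cst|exact: cvg_ln_div_sqrt].
apply: cvg_trans; apply: near_eq_cvg; exists 1%N => // k /= k0.
by rewrite lnXn ?ltr0n// -[ln _ *+ n]mulr_natl mulrA.
Qed.

Lemma cvg_ln_expN_div_sqrt (n : nat) :
  ln (k%:R ^- n) / Num.sqrt k%:R @[k --> \oo] --> (0 : R).
Proof.
have /cvgN := cvg_ln_exp_div_sqrt n; rewrite oppr0; apply: cvg_trans.
apply: near_eq_cvg; exists 1%N => // k /= k0.
by rewrite fctE lnV ?posrE ?exprn_gt0 ?ltr0n// mulNr.
Qed.

Lemma cvg_expN2 : (k%:R ^- 2 : R) @[k --> \oo] --> (0 : R).
Proof.
apply/cvgr0Pnorm_le => e e0; near=> k.
have k1 : 1 <= k%:R :> R by near: k; exact: nbhs_infty_ger.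
have ke : e^-1 <= k%:R by near: k; exact: nbhs_infty_ger.
rewrite ger0_norm ?invr_ge0 ?exprn_ge0// invf_ple ?posrE ?exprn_gt0//; last by lra.
by rewrite (le_trans ke)// expr2 ler_peMr//; lra.
Unshelve. all: by end_near. Qed.

Variables (p : R) (p01 : 0 <= p <= 1) (N : nat -> nat) (x : binseq).

Let low k := [pred w : k.-tuple bool | (N k)%:R * word_pmf p w <= k%:R ^- 4].
Let mid k := [pred w : k.-tuple bool | (N k)%:R * word_pmf p w <= k%:R ^+ 6].
Let err k := word_prob p (mismatch p (N k) x (k := k)).

Lemma occurrences0_ge k : (0 < k)%N -> word_prob p (low k) - err k <=
  word_prob p [pred w : k.-tuple bool | occurrences (N k) x w == 0%N].
Proof.
move=> k0; rewrite lerBlDr; apply: le_trans (word_probU _ _ _) => //.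
apply: le_word_prob => // w /= lw; rewrite /mismatch lw /=.
by case: occurrences.
Qed.

(** A word whose mean exceeds k^6 and which occurs fewer than n <= k times is exceptional. *)
Lemma occurrences_lt n k : (n <= k)%N ->
  word_prob p [pred w : k.-tuple bool | (occurrences (N k) x w < n)%N] <=
  word_prob p (mid k) + err k.
Proof.
move=> nk; apply: le_trans (word_probU _ _ _) => //.
apply: le_word_prob => // w /= on; rewrite /mismatch.
by case: leP => //= _; rewrite (leq_trans on nk) orbT.
Qed.

(** A count strictly between 0 and k is exceptional for rare and for frequent words alike. What
    remains is the gap between the two thresholds, whose probability is a difference because [low]
    implies [mid]. *)
Lemma occurrences_eq n k : (0 < n < k)%N ->
  word_prob p [pred w : k.-tuple bool | occurrences (N k) x w == n] <=
  word_prob p (mid k) - word_prob p (low k) + err k.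
Proof.
move=> /andP[n0 nk].
have k1 : 1 <= k%:R :> R by rewrite ler1n (leq_trans _ nk).
have lm (w : k.-tuple bool) : low k w -> mid k w.
  move=> /= /le_trans; apply; rewrite (@le_trans _ _ 1) ?exprn_ege1//.
  by rewrite invf_le1 ?exprn_ege1// exprn_gt0//; lra.
(* Once the subtracted term is moved across, the bound holds word by word between sums of 0-1
   indicators. *)
rewrite addrAC lerBrDr /err !word_probE -!word_expD; apply: ler_word_exp => // w.
have := lm w; rewrite /= /mismatch ltNge -!natrD ler_nat.
case: (_ <= _ ^- 4) => [-> //|_] /=; last first.
  by case: eqP => [->|_] //=; rewrite nk andbT; case: (_ <= _).
by case: eqP => [->|_] //=; rewrite n0.
Qed.

End sandwich.

Unset Implicit Arguments.

Theorem theorem1p1 (R : realType) (p : R) (hp : 2^-1 < p < 1)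
    (N : nat -> nat) (hN : forall k : nat, (0 < k)%N -> (0 < N k)%N)
    (mu : probability binseq R) (hmu : is_bernoulli_product p mu) :
  {ae mu, forall x : binseq,
    [/\ (forall a : R, 0 < a -> is_o (fun k => (N k)%:R) (scale p a)) ->
          word_prob p [pred w : k.-tuple bool | occurrences (N k) x w == 0%N]
            @[k --> \oo] --> (1 : R),
        (forall a : R, 0 < a -> is_omega (fun k => (N k)%:R) (scale p a)) ->
          forall n : nat,
          word_prob p [pred w : k.-tuple bool | (n <= occurrences (N k) x w)%N]
            @[k --> \oo] --> (1 : R)
      & forall a : R, 0 < a -> is_Theta (fun k => (N k)%:R) (scale p a) ->
          (word_prob p [pred w : k.-tuple bool | occurrences (N k) x w == 0%N]
            @[k --> \oo] -->
            Phi (- (log_base (p / (1 - p)) a / Num.sqrt (p * (1 - p))))) /\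
          (forall n : nat, (1 <= n)%N ->
            word_prob p [pred w : k.-tuple bool | occurrences (N k) x w == n]
              @[k --> \oo] --> (0 : R)) ]}.
Proof.
have p01 : 0 <= p <= 1 by move: hp; lra.
(* Randomness of x enters only here; the rest holds for each x whose mismatch probabilities are
   eventually at most k^-2. *)
apply: filterS (ae_mismatch p01 hmu N) => x err_le.
have err0 : word_prob p (mismatch p (N k) x (k := k)) @[k --> \oo] --> (0 : R).
  apply: (@squeeze_cvgr _ _ _ _ (fun=> 0) (fun k => k%:R ^- 2)).
  - by apply: filterS err_le => k ->; rewrite word_prob_ge0.
  - exact: cvg_cst.
  - exact: cvg_expN2.
have t4 k : (0 < k)%N -> 0 < k%:R ^- 4 :> R.
  by move=> k0; rewrite invr_gt0 exprn_gt0// ltr0n.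
have t6 k : (0 < k)%N -> 0 < k%:R ^+ 6 :> R.
  by move=> k0; rewrite exprn_gt0// ltr0n.
have l4 := @cvg_ln_expN_div_sqrt R 4.
have l6 := @cvg_ln_exp_div_sqrt R 6.
pose low k := word_prob p [pred w : k.-tuple bool |
  (N k)%:R * word_pmf p w <= k%:R ^- 4].
pose mid k := word_prob p [pred w : k.-tuple bool |
  (N k)%:R * word_pmf p w <= k%:R ^+ 6].
have hit0 (l : R) : low k @[k --> \oo] --> l -> mid k @[k --> \oo] --> l ->
  word_prob p [pred w : k.-tuple bool | occurrences (N k) x w == 0%N]
    @[k --> \oo] --> l.
  move=> lowl midl.
  apply: (@squeeze_cvgr _ _ _ _
    (fun k => low k - word_prob p (mismatch p (N k) x (k := k)))
    (fun k => mid k + word_prob p (mismatch p (N k) x (k := k)))).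
  - exists 1%N => // k /= k0; apply/andP; split; first exact: occurrences0_ge.
    (* Here [k0] is read as 1 <= k, so the bound is used with n = 1. *)
    apply: le_trans (occurrences_lt p01 N x k0); apply: le_word_prob => // w /=.
    by move/eqP => ->.
  - by rewrite -[X in _ --> X]subr0; exact: cvgB.
  - by rewrite -[X in _ --> X]addr0; exact: cvgD.
split.
- move=> ho; apply: hit0; exact: rare_o.
- move=> ho n.
  have mid0 : mid k @[k --> \oo] --> (0 : R) by exact: rare_omega.
  apply: (@squeeze_cvgr _ _ _ _
    (fun k => 1 - (mid k + word_prob p (mismatch p (N k) x (k := k)))) (fun=> 1)).
  + exists n => // k /= nk; rewrite word_prob_le1// andbT lerBlDr addrC -lerBlDr.
    apply: le_trans (occurrences_lt p01 N x nk).
    rewrite -word_probC//; apply: le_word_prob => // w /=.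
    by rewrite -ltnNge.
  + rewrite -[X in _ --> X]subr0; apply: cvgB; first exact: cvg_cst.
    by rewrite -[X in _ --> X]addr0; exact: cvgD.
  + exact: cvg_cst.
- move=> a a0 ha; have lowl := rare_Theta hp hN t4 l4 a0 ha.
  have midl := rare_Theta hp hN t6 l6 a0 ha.
  split=> [|n n1]; first exact: hit0.
  (* Both thresholds give the same Gaussian limit, so the probability of the gap between them tends
     to 0. *)
  apply: (@squeeze_cvgr _ _ _ _ (fun=> 0)
    (fun k => mid k - low k + word_prob p (mismatch p (N k) x (k := k)))).
  + exists n.+1 => // k /= nk; rewrite word_prob_ge0//=.
    by apply: occurrences_eq; rewrite ?n1.
  + exact: cvg_cst.
  + rewrite -[X in _ --> X]addr0; apply: cvgD => //.
    rewrite -(subrr (Phi (- (log_base (p / (1 - p)) a /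
      Num.sqrt (p * (1 - p)))))).
    exact: cvgB.
Qed.
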